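(* Let $X$ be a cobounded, $\delta$-hyperbolic, CAT(0), proper geodesic metric space. Let $cdim_v(\partial X)$ be the capacity dimension of $\partial X$ equipped with the visual metric $d_v$ and let $cdim_c(\partial X)$ be the capacity dimension of $\partial X$ equipped with the conical metric $d_c$. Then $$cdim_v(\partial X)=cdim_c(\partial X).$$ In particular, for a hyperbolic CAT(0) group $G$, one has $cdim_v(\partial G)=cdim_c(\partial G)$.
   Context: **Hyperbolicity and coboundedness.** Fix a base point $x_0\in X$ and write $(y|z)=\frac12\big(d(y,x_0)+d(z,x_0)-d(y,z)\big)$ for the Gromov product. $X$ is $\delta$-hyperbolic if $(x|z)_w\ge\min\{(x|y)_w,(y|z)_w\}-\delta$ for all $x,y,z,w\in X$, where $(\cdot|\cdot)_w$ is the Gromov product based at $w$. $X$ is cobounded if there is a bounded subset whose translates under the isometry group of $X$ cover $X$. A hyperbolic CAT(0) group is a Gromov hyperbolic group $G$ acting geometrically (properly discontinuously, cocompactly, by isometries) on a proper CAT(0) space $X$; $\partial G$ then means $\partial X$. **Boundary.** $\partial X$ is the boundary at infinity: equivalence classes of geodesic rays, each class being represented by a unique geodesic ray starting at $x_0$ (for a proper hyperbolic CAT(0) space this is identified with the Gromov boundary). **Visual metric.** For $a,b\in\partial X$, $(a|b)=\sup\liminf_{i,j\to\infty}(x_i|y_j)$, the supremum being over all sequences $x_i\to a$, $y_j\to b$ in $X$. Fix $\epsilon>0$ with $\epsilon'=e^{\epsilon\delta}-1\le\sqrt2-1$. Let $\rho_\epsilon(a,b)=e^{-\epsilon(a|b)}$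 and $$d_v(a,b)=d_\epsilon(a,b)=\inf\Big\{\sum_{i=1}^n\rho_\epsilon(a_{i-1},a_i)\Big\},$$ the infimum over all finite chains $a=a_0,a_1,\dots,a_n=b$ in $\partial X$. This is a metric with $(1-2\epsilon')\rho_\epsilon\le d_\epsilon\le\rho_\epsilon$. **Conical metric.** Fix $A>0$. For $[\gamma],[\gamma']\in\partial X$ represented by geodesic rays $\gamma,\gamma':[0,\infty)\to X$ starting at $x_0$, let $t\in(0,\infty)$ be such that $d(\gamma(t),\gamma'(t))=A$ (put $t=\infty$ if no such $t$ exists), and set $d_c([\gamma],[\gamma'])=d_{A,x_0}([\gamma],[\gamma'])=1/t$ (with $1/\infty=0$). **Capacity dimension.** For a cover $\mathcal U$ of a metric space $Z$: $order(\mathcal U)$ is the smallest $n$ such that every point lies in at most $n$ elements of $\mathcal U$; $mesh(\mathcal U)=\sup\{diam(U):U\in\mathcal U\}$; the Lebesgue number is $\mathcal L(\mathcal U)=\inf_{z\in Z}\sup\{d(z,Z\setminus U):U\in\mathcal U\}$. One says $cdim\, Z\le n$ if there exist $0<c\le1$ and $\lambda_0>0$ such that for all $0<\lambda\le\lambda_0$ there is a cover $\mathcal U$ of $Z$ with $order(\mathcal U)\le n+1$, $mesh(\mathcal U)\le\lambda$ and $\mathcal L(\mathcal U)\ge c\lambda$. $cdim\,Z$ is the least such $n$. *)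

(* Defs.v *)
From HB Require Import structures.
From mathcomp Require Import all_boot all_order all_algebra.
From mathcomp Require Import all_classical all_reals all_analysis.

Set Implicit Arguments.
Unset Strict Implicit.
Unset Printing Implicit Defensive.

Import Order.TTheory GRing.Theory Num.Theory.
Import numFieldNormedType.Exports.

Local Open Scope classical_set_scope.
Local Open Scope ring_scope.

Section Hyperbolic.
Context {R : realType} {T : Type}.
Implicit Types (d : T -> T -> R) (w x y z : T).

Definition gromov_product d w y z : R := (d y w + d z w - d y z) / 2.

Definition hyperbolic d (delta : R) : Prop :=
  forall x y z w,
    Num.min (gromov_product d w x y) (gromov_product d w y z) - delta
      <= gromov_product d w x z.

End Hyperbolic.

Section Spaces.
Context {R : realType}.

Definition proper_space (X : metricType R) : Prop :=
  forall (x : X) (r : R), compact [set y : X | mdist x y <= r].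

Definition geodesic_segment (X : metricType R) (c : R -> X) (x y : X) : Prop :=
  [/\ c 0 = x, c (mdist x y) = y &
      forall s t, 0 <= s <= mdist x y -> 0 <= t <= mdist x y ->
        mdist (c s) (c t) = `|s - t|].

Definition geodesic_space (X : metricType R) : Prop :=
  forall x y : X, exists c, geodesic_segment c x y.

(* The norm of the library on [R * R] is the sup norm, hence this definition. *)
Definition eucl_dist (u v : R * R) : R :=
  Num.sqrt ((u.1 - v.1) ^+ 2 + (u.2 - v.2) ^+ 2).

Definition affine_point (a : R) (u v : R * R) : R * R :=
  ((1 - a) * u.1 + a * v.1, (1 - a) * u.2 + a * v.2).

(* [p' q' r'] is a comparison triangle; the comparison point of the point at
   distance [a * mdist p q] from [p] on a side [p q] is [affine_point a p' q'].
   Two points on distinct sides of a geodesic triangle lie on sides with a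
   common vertex, called [p] here; for two points on one side, the CAT(0)
   inequality is an equality. *)
Definition cat0_inequality (X : metricType R) : Prop :=
  forall (p q r : X) (c1 c2 c3 : R -> X) (p' q' r' : R * R),
    geodesic_segment c1 p q -> geodesic_segment c2 p r ->
    geodesic_segment c3 q r ->
    eucl_dist p' q' = mdist p q -> eucl_dist p' r' = mdist p r ->
    eucl_dist q' r' = mdist q r ->
    forall a b : R, 0 <= a <= 1 -> 0 <= b <= 1 ->
      mdist (c1 (a * mdist p q)) (c2 (b * mdist p r))
        <= eucl_dist (affine_point a p' q') (affine_point b p' r').

Definition cat0 (X : metricType R) : Prop :=
  geodesic_space X /\ cat0_inequality X.

Definition isometry (X : metricType R) (f : X -> X) : Prop :=
  bijective f /\ forall x y, mdist (f x) (f y) = mdist x y.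

Definition cobounded (X : metricType R) : Prop :=
  exists B : set X,
    (exists M : R, forall x y, B x -> B y -> mdist x y <= M) /\
    (forall x : X, exists f, isometry f /\ (f @` B) x).

End Spaces.

Section Boundary.
Context {R : realType} {X : metricType R}.

(* A ray is a function on [0, +oo[; its values on negative reals are
   irrelevant in all that follows. *)
Definition geodesic_ray (g : R -> X) : Prop :=
  forall s t, 0 <= s -> 0 <= t -> mdist (g s) (g t) = `|s - t|.

Definition asymptotic (g h : R -> X) : Prop :=
  exists K : R, forall t, 0 <= t -> mdist (g t) (h t) <= K.

Definition ray_class (g : R -> X) : set (R -> X) :=
  [set h | geodesic_ray h /\ asymptotic g h].

End Boundary.

Definition boundary {R : realType} (X : metricType R) : Type :=
  {a : set (R -> X) | exists2 g, geodesic_ray g & a = ray_class g}.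

Section BoundaryMetrics.
Context {R : realType} {X : metricType R}.
Implicit Types (x y : nat -> X) (a b : boundary X).

Definition gromov_equiv (x0 : X) x y : Prop :=
  gromov_product mdist x0 (x ij.1) (y ij.2)
    @[ij --> filter_prod (\oo : set_system nat) (\oo : set_system nat)] --> +oo.

(* [x_i --> a] in the Gromov boundary: [x] converges at infinity and is
   equivalent to the sequence of integer points of a ray of the class [a]. *)
Definition cvg_boundary (x0 : X) x a : Prop :=
  gromov_equiv x0 x x /\
  exists2 g, sval a g & gromov_equiv x0 x (fun n => g n%:R).

Definition boundary_product (x0 : X) a b : \bar R :=
  ereal_sup [set l | exists x y, [/\ cvg_boundary x0 x a, cvg_boundary x0 y b &
    l = limf_einf
          (fun ij : nat * nat =>
             (gromov_product mdist x0 (x ij.1) (y ij.2))%:E)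
          (filter_prod (\oo : set_system nat) (\oo : set_system nat))]].

(* [rho = 0] if the Gromov product is [+oo], as [expeR -oo = 0] *)
Definition visual_rho (x0 : X) (eps : R) a b : R :=
  fine (expeR (- (eps%:E * boundary_product x0 a b))%E).

Definition visual_dist (x0 : X) (eps : R) a b : R :=
  inf [set s | exists (n : nat) (c : nat -> boundary X),
    [/\ c 0%N = a, c n = b &
        s = \sum_(i < n) visual_rho x0 eps (c i) (c i.+1)]].

Definition conical_time (x0 : X) (A : R) a b : set R :=
  [set t | 0 < t /\ exists g h,
    [/\ sval a g, sval b h, g 0 = x0, h 0 = x0 & mdist (g t) (h t) = A]].

(* If there is no such [t], then [xget] returns [0], and [0^-1 = 0] agrees
   with the convention [1/oo = 0]. *)
Definition conical_dist (x0 : X) (A : R) a b : R :=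
  (xget 0 (conical_time x0 A a b))^-1.

End BoundaryMetrics.

Section CapacityDimension.
Context {R : realType} {Z : Type}.
Implicit Types (d : Z -> Z -> R) (U : set Z) (C : set (set Z)).
Local Open Scope ereal_scope.

Definition covering C : Prop := \bigcup_(U in C) U = setT.

Definition order_at_most C (n : nat) : Prop :=
  forall z, ([set U | C U /\ U z] #<= `I_n)%card.

(* [+oo] if the order is not finite *)
Definition cover_order C : \bar R :=
  ereal_inf [set n%:R%:E | n in order_at_most C].

(* [0] is added so that the empty set has diameter [0]. *)
Definition diameter d U : \bar R :=
  ereal_sup (0 |` [set e | exists x y, [/\ U x, U y & e = (d x y)%:E]]).

Definition mesh d C : \bar R := ereal_sup [set diameter d U | U in C].

(* [+oo] if [U] is empty *)
Definition dist_set d (z : Z) U : \bar R :=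
  ereal_inf [set (d z w)%:E | w in U].

Definition lebesgue_number d C : \bar R :=
  ereal_inf [set ereal_sup [set dist_set d z (~` U) | U in C] | z in setT].

Definition cdim_le d (n : nat) : Prop :=
  exists c lambda0 : R, [/\ (0 < c <= 1)%R, (0 < lambda0)%R &
    forall lambda : R, (0 < lambda <= lambda0)%R ->
      exists C : set (set Z),
        [/\ covering C, cover_order C <= n.+1%:R%:E, mesh d C <= lambda%:E &
            (c * lambda)%:E <= lebesgue_number d C]].

(* [+oo] if there is no such [n] *)
Definition cdim d : \bar R := ereal_inf [set n%:R%:E | n in cdim_le d].

End CapacityDimension.

Section Groups.
Context {R : realType}.

Definition word_in (G : groupType) (S : set G) (s : seq G) : Prop :=
  forall u, u \in s -> S u \/ S (u^-1)%g.

Definition generates (G : groupType) (S : set G) : Prop :=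
  forall g : G, exists2 s, word_in S s & (\prod_(u <- s) u)%g = g.

Definition word_dist (G : groupType) (S : set G) (g h : G) : R :=
  inf [set (size s)%:R |
    s in [set s | word_in S s /\ (\prod_(u <- s) u)%g = (g^-1 * h)%g]].

Definition geometric_action (G : groupType) (X : metricType R)
    (act : G -> X -> X) : Prop :=
  [/\ (forall x, act 1%g x = x) /\
        (forall g h x, act (g * h)%g x = act g (act h x)),
      forall g x y, mdist (act g x) (act g y) = mdist x y,
      forall K : set X, compact K ->
        finite_set [set g | act g @` K `&` K !=set0] &
      exists K : set X, compact K /\ \bigcup_g (act g @` K) = setT].

End Groups.

(* The four-point condition is imposed on [G] itself, that is on the vertices of
   its Cayley graph; passing to the whole graph only changes [delta]. *)
Definition hyperbolic_group (R : realType) (G : groupType) : Prop :=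
  exists (S : set G) (delta : R),
    [/\ finite_set S, generates S & hyperbolic (@word_dist R G S) delta].

(* Main.v *)
Require Import Defs.
From HB Require Import structures.
From Stdlib Require Import Relation_Operators.
From mathcomp Require Import all_boot all_order all_algebra.
From mathcomp Require Import all_classical all_reals all_analysis.
From mathcomp Require Import zify ring lra.
Import Order.TTheory GRing.Theory Num.Theory.
Import numFieldNormedType.Exports.
Local Open Scope classical_set_scope.
Local Open Scope ring_scope.

(** Write [(a|b)] for the Gromov product of two boundary points.  Up to
    constants the visual metric is [exp (- eps * (a|b))] and the conical metric
    is [1 / (a|b)].  For the second fact, convexity of the distance between two
    rays issued from [x0] makes the times at which this distance takes two given
    positive values comparable up to a factor, and hyperbolicity identifies one
    of these times with [(a|b)] up to an additive error.  So a cover of scale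
    [l] is a cover by sets in which [(a|b) >= s], where [s] is about
    [- ln l / eps] in the visual case and about [1 / l] in the conical case; a
    Lebesgue number comparable to the mesh allows an additive loss on [s] for
    the visual metric, but a multiplicative loss for the conical one.  The
    visual condition is therefore the stronger one, and the point is to recover
    it from the conical condition.

    All this is phrased with a family of relations [P s a b], read as
    [(a|b) >= s] and realised by [agree]: the rays of [a] and [b] are still
    close at time [s].  Covers of order [n.+1] are replaced by colourings with
    [n.+1] colours ([colourable]), a translation that costs nothing
    ([colouring_of_cover], [cover_of_colouring]).  The core is
    [colourable_rescale]: if for every [s] there is a colouring of scale [s]
    with some separation, however bad, then there are colourings whose
    separation is within a fixed additive constant of their scale.  This is the
    principle of Buyalo and Lebedeva that the capacity dimension of a
    self-similar compact space is its topological dimension.  The isometries of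
    a cobounded [X] carry a boundary ball of scale [s] onto a piece of the
    boundary of scale [0] ([agree_self_similar]), so that every such ball
    inherits a fixed colouring of the boundary.  Balls of scale [s] have bounded
    multiplicity ([agree_doubling]), so they split into boundedly many families
    of well separated balls, and these families are absorbed one after the other
    ([colourable_union]), each one coloured much more finely than the previous
    ones are separated.  Since only the topology enters in the hypothesis, both
    metrics have the capacity dimension defined by the good colourings
    ([cdim_gauged_eq]).

    The comparison of the visual metric with [agree] needs the chain lemma
    [chain_length_ge]: a quasi-metric with constant at most [2] is at most four
    times its chain metric.  The Gromov product on the boundary satisfies the
    hyperbolic inequality with [2 * delta], and the condition on [eps] says
    exactly that [exp (eps * (2 * delta)) <= 2].

    For a group it remains to transfer hyperbolicity from [G] to [X].  The orbit
    map is a quasi-isometry ([orbit_lipschitz], [orbit_expanding]), it sends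
    geodesics of [X] to quasi-geodesics of the word metric, and these are
    uniformly close to geodesics by the Morse lemma
    ([quasi_geodesic_near_line], [quasi_geodesic_meets]).  Hence the triangles of
    [X] are thin, and [X] is hyperbolic ([hyperbolic_of_quasi_isometry]). *)

Set Implicit Arguments.
Unset Strict Implicit.
Unset Printing Implicit Defensive.

(** * Covers and colourings *)

Section NestedSets.
Context {T : Type}.

(** Pigeonhole: each strict inclusion would use up one of the [n.+1] elements
    available, and the first set already has one. *)
Lemma nested_sets_stabilise (J : nat -> set T) (A : set T) (n : nat) :
  (A #<= `I_n.+1)%card -> J 0 !=set0 ->
  (forall k, J k `<=` J k.+1) -> (forall k, (k <= n.+1)%N -> J k `<=` A) ->
  exists2 k, (k <= n)%N & J k = J k.+1.
Proof.
move=> /pcard_leP/injfunPex[f fA finj] J0 Jmono JA; apply: contrapT => noeq.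
pose S k := [set i : 'I_n.+1 | `[< exists2 U, J k U & f U = i >]]%SET.
suff : (n.+1 < #|S n.+1|)%N.
  by move=> /leq_trans/(_ (max_card _)); rewrite card_ord ltnn.
have SP k i : i \in S k <-> exists2 U, J k U & f U = i.
  by rewrite inE; split=> /asboolP.
suff H k : (k <= n.+1)%N -> (k < #|S k|)%N by exact: H.
elim: k => [_|k IH kn].
  have [U JU] := J0; apply/card_gt0P.
  have fU : (f U < n.+1)%N by exact: (fA U (JA 0%N isT _ JU)).
  by exists (Ordinal fU); apply/SP; exists U.
apply: leq_ltn_trans (IH (ltnW kn)) _; apply: proper_card; apply/properP; split.
  by apply/fintype.subsetP => i /SP[U JU fU]; apply/SP; exists U => //; exact: Jmono.
have [U JU nJU] : exists2 U, J k.+1 U & ~ J k U.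
  apply: contrapT => H; apply: noeq; exists k; first by rewrite -ltnS.
  apply/seteqP; split; first exact: Jmono.
  by move=> U JU; apply: contrapT => nJU; apply: H; exists U.
have fU : (f U < n.+1)%N by exact: (fA U (JA _ kn _ JU)).
exists (Ordinal fU); first by apply/SP; exists U.
apply/negP => /SP[V JV /= fV]; apply: nJU.
suff <- : V = U by [].
apply: finj => //; rewrite inE.
  by apply: (JA _ kn); apply: Jmono.
exact: (JA _ kn).
Qed.

End NestedSets.

Section Colourings.
Context {R : realType} {Z : Type}.
Implicit Types (P : R -> Z -> Z -> Prop) (Y : set Z) (s t T C : R) (n : nat).

(** [P t a b] is to be read as: the Gromov product of [a] and [b] is at least
    [t].  Only the family of relations matters, so that no value has to be given
    to the product of a point with itself; [C] is the defect of the ultrametric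
    inequality. *)
Record scale_relation P C : Prop := ScaleRelation {
  scale_defect_ge0 : 0 <= C;
  scale_refl : forall t a, P t a a;
  scale_sym : forall t a b, P t a b -> P t b a;
  scale_mono : forall s t a b, s <= t -> P t a b -> P s a b;
  scale_trans : forall t a b c, P t a b -> P t b c -> P (t - C) a c }.

Definition link P n (col : Z -> 'I_n) Y T (a b : Z) : Prop :=
  [/\ Y a, Y b, col a = col b & P T a b].

Definition chain P n (col : Z -> 'I_n) Y T : Z -> Z -> Prop :=
  clos_refl_trans_n1 Z (link P col Y T).

(** The chain components of the colour classes play the part of the members of a
    cover: components of one colour are apart at scale [T], each of them is small
    at scale [s], and each point lies in exactly one component.  Speaking of
    chains only, rather than of the components, makes it easy to combine
    colourings of two sets. *)
Definition colourable P n Y s T : Prop :=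
  exists col : Z -> 'I_n.+1, forall a b, chain P col Y T a b -> P s a b.

Lemma chain_col P n (col : Z -> 'I_n) Y T a b :
  chain P col Y T a b -> col a = col b.
Proof. by elim=> // y z [_ _ <- _] _. Qed.

Lemma chain_link P n (col : Z -> 'I_n) Y T a b :
  link P col Y T a b -> chain P col Y T a b.
Proof. by move=> ab; apply: rtn1_trans ab _; exact: rtn1_refl. Qed.

Lemma chain_catl P n (col : Z -> 'I_n) Y T a b c :
  chain P col Y T a b -> chain P col Y T b c -> chain P col Y T a c.
Proof. by move=> ab; elim=> // y z yz _ ay; apply: rtn1_trans yz ay. Qed.

Lemma chain_sym P C n (col : Z -> 'I_n) Y T a b : scale_relation P C ->
  chain P col Y T a b -> chain P col Y T b a.
Proof.
move=> SP; elim=> [|y z [Yy Yz yz Pyz] _ IH]; first exact: rtn1_refl.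
by apply: chain_catl IH; apply: chain_link; split=> //; exact: (scale_sym SP).
Qed.

Lemma colourable_weaken P C n Y s T s' T' : scale_relation P C ->
  s' <= s -> T <= T' -> colourable P n Y s T -> colourable P n Y s' T'.
Proof.
move=> SP ss TT [col colP]; exists col => a b ab.
apply: (scale_mono SP ss); apply: colP; elim: ab => [|y z [Yy Yz yz Pyz] _ IH].
  exact: rtn1_refl.
by apply: rtn1_trans IH; split=> //; exact: (scale_mono SP TT).
Qed.

(** Let [J z k] be the set of the members of the cover that contain the ball of
    scale [T + k * C] around [z].  These sets increase with [k] and have between
    [1] and [n.+1] elements, so [J z k = J z k.+1] for some [k <= n], and this
    [k] is taken as the colour of [z].  When two points of colour [k] are close
    the stationarity forces [J] to be the same for both; hence a monochromatic
    chain stays inside a single member of the cover. *)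
Lemma colouring_of_cover P C (d : Z -> Z -> R) (D : set (set Z)) n (l c s T : R) :
  scale_relation P C -> 0 < c ->
  covering D -> (cover_order D <= n.+1%:R%:E :> \bar R)%E -> (mesh d D <= l%:E)%E ->
  (c%:E <= lebesgue_number d D)%E ->
  (forall a b, d a b <= l -> P s a b) ->
  (forall a b, P T a b -> d a b <= c / 2) ->
  exists T', colourable P n setT s T'.
Proof.
move=> SP c0 Dcov Dord Dmesh Dleb ds dT.
have C0 := scale_defect_ge0 SP.
have ordz z : ([set U | D U /\ U z] #<= `I_n.+1)%card.
  have [m mord mn] : exists2 m, order_at_most D m & (m <= n.+1)%N.
    have : (cover_order D < n.+2%:R%:E :> \bar R)%E.
      by apply: le_lt_trans Dord _; rewrite lte_fin ltr_nat.
    move=> /ereal_inf_lt[_ [m mord <-]]; rewrite lte_fin ltr_nat => mn.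
    by exists m.
  by apply: card_le_trans (mord z) _; rewrite card_le_II.
pose J z k := [set U | D U /\ forall w, P (T + k%:R * C) z w -> U w].
have JU z k U : J z k U -> U z by case=> _; apply; exact: (scale_refl SP).
have Jmono z k : J z k `<=` J z k.+1.
  move=> U [DU UP]; split=> // w zw; apply: UP; apply: (scale_mono SP _ zw).
  by rewrite lerD2l ler_wpM2r// ler_nat.
have Jmono0 z k : J z 0 `<=` J z k.
  by elim: k => // k IH U /IH; exact: Jmono.
have J0 z : J z 0 !=set0.
  have : (lebesgue_number d D <= ereal_sup [set dist_set d z (~` U) | U in D])%E.
    by apply: ereal_inf_lbound; exists z.
  move=> /(le_trans Dleb) H.
  have : ((c / 2)%:E < ereal_sup [set dist_set d z (~` U) | U in D])%E.
    by apply: lt_le_trans H; rewrite lte_fin; lra.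
  move=> /ereal_sup_gt[_ [U DU <-]] cU; exists U; split=> // w.
  rewrite mul0r addr0 => /dT zw; apply: contrapT => nUw.
  have : (dist_set d z (~` U) <= (d z w)%:E)%E.
    by apply: ereal_inf_lbound; exists w.
  by move=> /(lt_le_trans cU); rewrite lte_fin ltNge zw.
have kP z : exists k : 'I_n.+1, J z k = J z k.+1.
  have [k kn Jk] : exists2 k, (k <= n)%N & J z k = J z k.+1.
    apply: (nested_sets_stabilise (ordz z) (J0 z) (Jmono z)) => k _ U JzU.
    by split; [case: JzU | exact: JU JzU].
  by exists (Ordinal (kn : (k < n.+1)%N)).
have [col colP] := choice kP.
exists (T + n.+1%:R * C), col => a b ab.
have Jlink k u v : (k <= n)%N -> P (T + n.+1%:R * C) u v -> J u k `<=` J v k.+1.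
  move=> kn uv U [DU UP]; split=> // w vw; apply: UP.
  have uv' : P (T + k.+1%:R * C) u v.
    by apply: (scale_mono SP _ uv); rewrite lerD2l ler_wpM2r// ler_nat.
  apply: (scale_mono SP _ (scale_trans SP uv' vw)).
  by rewrite -natr1 mulrDl mul1r; lra.
have Jeq : J a (col a) `<=` J b (col a).
  elim: ab => // u v [_ _ uv Puv] /chain_col au IH.
  have Jv := colP v.
  rewrite -uv -au in Jv; rewrite Jv.
  by move=> U /IH; apply: Jlink => //; rewrite -ltnS.
have [U JaU] := J0 a.
have DU : D U by case: JaU.
have Ua := JU _ _ _ JaU.
have Ub : U b := JU _ _ _ (Jeq _ (Jmono0 _ _ _ JaU)).
apply: ds; rewrite -lee_fin; apply: le_trans Dmesh.
apply: (@le_trans _ _ (diameter d U)).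
  by apply: ereal_sup_ubound; right; exists a, b.
by apply: ereal_sup_ubound; exists U.
Qed.

(** The members of the cover are the chain components, thickened by balls of
    scale [T + C].  Thickened components of the same colour that meet are equal,
    because their cores are then linked at scale [T]. *)
Lemma cover_of_colouring P C (d : Z -> Z -> R) n (l c s T : R) :
  scale_relation P C -> 0 <= l -> s <= T + C ->
  colourable P n setT s T ->
  (forall a b, P (s - 2 * C) a b -> d a b <= l) ->
  (forall a b, d a b < c -> P (T + C) a b) ->
  exists D : set (set Z),
    [/\ covering D, (cover_order D <= n.+1%:R%:E :> \bar R)%E, (mesh d D <= l%:E)%E &
      (c%:E <= lebesgue_number d D)%E].
Proof.
move=> SP l0 sT [col colP] ds dT.
have C0 := scale_defect_ge0 SP.
pose N a := [set z | exists2 b, chain P col setT T a b & P (T + C) b z].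
have NN a : N a a.
  by exists a; [exact: rtn1_refl | exact: (scale_refl SP)].
exists (range N); split.
- by apply/seteqP; split=> // z _; exists (N z) => //; exists z.
- apply: ereal_inf_lbound; exists n.+1 => // z.
  have [r rP] : exists r : set Z -> Z, forall U, range N U -> N (r U) = U.
    have [r rP] : {r : set Z -> Z & forall U, range N U -> N (r U) = U}.
      apply: (@choice _ _ (fun U a => range N U -> N a = U)) => U.
      have [[a _ <-]|nU] := pselect (range N U); first by exists a.
      by exists z.
    by exists r.
  apply/pcard_leP/injfunPex; exists (fun U => col (r U) : nat) => [U _|U V].
    exact: ltn_ord.
  rewrite !inE => -[DU Uz] [DV Vz] /ord_inj aa'; rewrite -(rP U DU) -(rP V DV).
  have [b ab bz] : N (r U) z by rewrite rP.
  have [b' ab' bz'] : N (r V) z by rewrite rP.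
  have bb' : link P col setT T b b'.
    split=> //; first by rewrite -(chain_col ab) -(chain_col ab').
    by rewrite -(addrK C T); exact: (scale_trans SP bz (scale_sym SP bz')).
  have H u v : chain P col setT T u v -> N v `<=` N u.
    by move=> uv w [x vx xw]; exists x => //; exact: chain_catl vx.
  have aca' : chain P col setT T (r U) (r V).
    apply: chain_catl ab _; apply: chain_catl (chain_link bb') _.
    exact: (chain_sym SP).
  by apply/seteqP; split; apply: H => //; exact: (chain_sym SP).
- apply: ub_ereal_sup => _ [_ [a _ <-] <-].
  apply: ub_ereal_sup => _ [->|[z [z' [[b ab bz] [b' ab' bz'] ->]]]].
    by rewrite lee_fin.
  rewrite lee_fin; apply: ds.
  have bb' : P s b b'.
    by apply: colP; apply: chain_catl ab'; exact: (chain_sym SP).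
  have zb : P s z b.
    by apply: (scale_sym SP); exact: (scale_mono SP _ bz).
  have bz2 : P (s - C) b' z'.
    by apply: (scale_mono SP _ bz'); lra.
  apply: (scale_mono SP _ (scale_trans SP (scale_trans SP zb bb') bz2)).
  lra.
- apply: le_ereal_inf_tmp => _ [z _ <-].
  apply: (@le_trans _ _ (dist_set d z (~` N z))); last first.
    by apply: ereal_sup_ubound; exists (N z) => //; exists z.
  apply: le_ereal_inf_tmp => _ [w nNw <-]; rewrite lee_fin leNgt; apply/negP.
  move=> /dT zw; apply: nNw; exists z => //; exact: rtn1_refl.
Qed.

End Colourings.

(** * Improving colourings by self-similarity *)

Lemma greedy_colouring (e : rel nat) (J m : nat) :
  (forall i, (i < m)%N -> (size [seq j <- iota 0 i | e j i] < J)%N) ->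
  exists k : nat -> nat, (forall i, (i < m)%N -> (k i < J)%N) /\
    forall i j, (j < i < m)%N -> e j i -> k j <> k i.
Proof.
elim: m => [_|m IH eJ]; first by exists (fun=> 0%N); split=> // i j; rewrite andbF.
have [i im|k [kJ kP]] := IH; first by apply: eJ; exact: ltnW.
pose s := [seq k j | j <- iota 0 m & e j m].
have [c cJ cs] : exists2 c, (c < J)%N & c \notin s.
  apply: contrapT => H.
  have /uniq_leq_size : uniq (iota 0 J) by exact: iota_uniq.
  move=> /(_ s); rewrite size_iota size_map leqNgt eJ// => Hs.
  suff : false by []; apply: Hs => c; rewrite mem_iota add0n => /= cJ.
  by apply: contrapT => /negP cs; apply: H; exists c.
exists (fun i => if i == m then c else k i); split=> [i|i j /andP[ji]].
  by rewrite ltnS leq_eqVlt; case: eqP => [->|_] //= im; exact: kJ.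
rewrite ltnS leq_eqVlt => /orP[/eqP im|im] eji; last first.
  by rewrite !ltn_eqF// ?(ltn_trans ji)//; apply: kP => //; rewrite ji.
rewrite im eqxx ltn_eqF -?im// => kc; move/negP: cs; apply.
apply/mapP; exists j; last by rewrite kc.
by rewrite mem_filter -im eji mem_iota.
Qed.

Section SelfSimilar.
Context {R : realType} {Z : Type}.
Variables (P : R -> Z -> Z -> Prop) (C : R).
Hypothesis SP : scale_relation P C.
Implicit Types (Y : set Z) (s t T : R) (n : nat).
Local Lemma C_ge0 : 0 <= C. Proof. exact: scale_defect_ge0 SP. Qed.



Lemma colourable_set0 n s T : colourable P n set0 s T.
Proof.
exists (fun=> ord0) => a b ab; suff -> : b = a by exact: (scale_refl SP).
by elim: ab => // y z [].
Qed.

(** Colour [Y1] by its own colouring and only the rest of [Y2] by that of [Y2].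
    An excursion of a monochromatic chain outside [Y1] is confined to scale [s2],
    which is finer than the separation [T1]; so the successive visits to [Y1]
    form a chain for the first colouring, and the ends of the chain are close to
    the first and to the last visit. *)
Lemma colourable_union n Y1 Y2 s1 T1 s2 T2 :
  s1 <= s2 -> T1 + 2 * C <= s2 -> s2 <= T2 ->
  colourable P n Y1 s1 T1 -> colourable P n Y2 s2 T2 ->
  colourable P n (Y1 `|` Y2) (s1 - 3 * C) T2.
Proof.
move=> s12 Ts2 sT2 [col1 H1] [col2 H2].
pose col a := if `[< Y1 a >] then col1 a else col2 a.
have colY1 a : Y1 a -> col a = col1 a by move=> Ya; rewrite /col; case: asboolP.
have colN1 a : ~ Y1 a -> col a = col2 a by move=> nYa; rewrite /col; case: asboolP.
have C0 := C_ge0; exists col => a b ab.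
(* [v] and [v'] are the first and the last visit of the chain to [Y1]. *)
pose inv b := (~ Y1 b /\ chain P col2 Y2 T2 a b) \/
  exists v v', [/\ Y1 v', col a = col v', P (s2 - C) a v, chain P col1 Y1 T1 v v' &
    b = v' \/ ~ Y1 b /\ exists2 w, P T2 v' w & chain P col2 Y2 T2 w b].
have Ps2 x y : P T2 x y -> P s2 x y by exact: (scale_mono SP).
have PT1 x y : P T2 x y -> P T1 x y by apply: (scale_mono SP); lra.
have {ab} : chain P col (Y1 `|` Y2) T2 a b /\ inv b.
  elim: ab => [|y z yz ay [_ IH]].
    split; first exact: rtn1_refl.
    have [Ya|nYa] := pselect (Y1 a); [right|left].
      exists a, a; split=> //; [exact: (scale_refl SP)|exact: rtn1_refl|by left].
    by split=> //; exact: rtn1_refl.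
  split; first by apply: rtn1_trans ay.
  case: yz => Yy Yz colyz Pyz; have cola := chain_col ay.
  have [Y1z|nY1z] := pselect (Y1 z).
    case: IH => [[nYy ay2]|[v [v' [Yv' av' av vv' y']]]]; right.
      exists z, z; split=> //; first by rewrite cola.
      - by apply: (scale_trans SP (H2 _ _ ay2)); exact: Ps2.
      - exact: rtn1_refl.
      - by left.
    exists v, z; split=> //; [by rewrite cola| |by left].
    have v'z : col1 v' = col1 z by rewrite -!colY1// -av' cola.
    case: y' => [yv'|[nYy [w v'w wy]]].
      by apply: rtn1_trans vv'; split=> //; rewrite -yv'; exact: PT1.
    apply: rtn1_trans vv'; split=> //.
    have v'y := scale_trans SP (Ps2 _ _ v'w) (H2 _ _ wy).
    have yz' : P (s2 - C) y z by apply: (scale_mono SP _ Pyz); lra.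
    by apply: (scale_mono SP _ (scale_trans SP v'y yz')); lra.
  have Y2z : Y2 z by case: Yz.
  have lk : ~ Y1 y -> link P col2 Y2 T2 y z.
    by move=> nYy; split=> //; [case: Yy|rewrite -!colN1].
  case: IH => [[nYy ay2]|[v [v' [Yv' av' av vv' y']]]]; [left|right].
    by split=> //; apply: rtn1_trans (lk nYy) ay2.
  exists v, v'; split=> //; right; split=> //.
  case: y' => [yv'|[nYy [w v'w wy]]].
    by exists z; [rewrite -yv'|exact: rtn1_refl].
  by exists w => //; apply: rtn1_trans (lk nYy) wy.
case=> _ [[_ ab]|[v [v' [_ _ av vv' vb]]]].
  by apply: (scale_mono SP _ (H2 _ _ ab)); lra.
have av' : P (s1 - 2 * C) a v'.
  have av2 : P (s1 - C) a v by apply: (scale_mono SP _ av); lra.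
  have vv2 : P (s1 - C) v v' by apply: (scale_mono SP _ (H1 _ _ vv')); lra.
  by apply: (scale_mono SP _ (scale_trans SP av2 vv2)); lra.
have v'b : P (s1 - 2 * C) v' b.
  case: vb => [->|[_ [w v'w wb]]]; first exact: (scale_refl SP).
  apply: (scale_mono SP _ (scale_trans SP (Ps2 _ _ v'w) (H2 _ _ wb))); lra.
by apply: (scale_mono SP _ (scale_trans SP av' v'b)); lra.
Qed.

(** The separation [tau] depends on the number [J] of sets but not on [s] nor on
    the sets: in the induction, the last set is coloured at a scale [sg] chosen
    beyond the separation already reached by the others.  The induction
    hypothesis is used at [sigma + 3 * C] to pay for the loss of scale in
    [colourable_union]. *)
Lemma colourable_bigcup n (D : R) (J : nat) :
  0 <= D ->
  (forall s, exists T, colourable P n setT s T) ->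
  forall sigma : R, 0 <= sigma -> exists2 tau : R, 0 <= tau &
  forall s (Y : nat -> set Z),
    (forall a (sg ta : R), 0 <= sg -> 0 <= ta -> colourable P n setT sg ta ->
      colourable P n (Y a) (s + sg - D) (s + ta + D)) ->
    colourable P n (\bigcup_(a < J) Y a) (s + sigma) (s + tau).
Proof.
move=> D0 W; have C0 := C_ge0; elim: J => [|J IH] sigma s0.
  exists 0 => // s Y _; rewrite (_ : \bigcup_(a < _) _ = set0).
    exact: colourable_set0.
  by apply/seteqP; split=> // z [].
have [|tau t0 tauP] := IH (sigma + 3 * C); first by lra.
pose sg := sigma + 3 * C + tau + 2 * C + D.
have [T WT] := W sg.
pose ta := Num.max T sg.
have Tta : T <= ta by rewrite le_max lexx.
have sgta : sg <= ta by rewrite le_max lexx orbT.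
exists (ta + D) => [|s Y HY]; first by rewrite /sg in sgta; lra.
rewrite bigcup_mkord big_ord_recr /= -bigcup_mkord.
rewrite (_ : s + sigma = s + (sigma + 3 * C) - 3 * C); last by lra.
rewrite (addrA s ta D).
have H2 : colourable P n (Y J) (s + sg - D) (s + ta + D).
  apply: HY; [rewrite /sg; lra|rewrite /sg in sgta; lra|].
  exact: (colourable_weaken SP (lexx _) Tta).
apply: colourable_union (tauP s Y HY) H2; rewrite /sg in sgta *; lra.
Qed.

(** Bounded multiplicity: the number of [s]-separated points in a ball that is
    larger by [D] is bounded independently of the scale [s]. *)
Definition doubling : Prop := forall D : R, 0 <= D -> exists J : nat,
  forall s w (m : nat) (z : nat -> Z), 0 <= s ->
    (forall i j, (i < j < m)%N -> ~ P s (z i) (z j)) ->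
    (forall i, (i < m)%N -> P (s - D) w (z i)) -> (m <= J)%N.

(** The ball of scale [s] around [w] is magnified by [F] to scale [0], up to an
    additive error [D]. *)
Definition self_similar : Prop := exists2 D, 0 <= D &
  forall s w, 0 <= s -> exists F : Z -> Z,
    forall a b, P s w a -> P s w b -> forall t, 0 <= t ->
      (P t (F a) (F b) -> P (s + t - D) a b) /\
      (P (s + t) a b -> P (t - D) (F a) (F b)).

(** A link of a chain cannot jump from one ball to another, so that inside one
    ball the magnification turns the chain into a chain of the given colouring. *)
Lemma colourable_separated_balls n (D s sg ta : R) (I : set nat) (z : nat -> Z)
    (F : nat -> Z -> Z) :
  0 <= D -> 0 <= sg -> 0 <= ta ->
  (forall i a b, I i -> P s (z i) a -> P s (z i) b -> forall t, 0 <= t ->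
      (P t (F i a) (F i b) -> P (s + t - D) a b) /\
      (P (s + t) a b -> P (t - D) (F i a) (F i b))) ->
  (forall i j, I i -> I j -> P (s - 2 * C) (z i) (z j) -> i = j) ->
  colourable P n setT sg ta ->
  colourable P n (\bigcup_(i in I) P s (z i)) (s + sg - D) (s + ta + D).
Proof.
have C0 := C_ge0; move=> D0 sg0 ta0 FP Isep [col colP].
have : forall a, exists i, (\bigcup_(i in I) P s (z i)) a -> I i /\ P s (z i) a.
  move=> a; have [[i Ii Pa]|na] := pselect ((\bigcup_(i in I) P s (z i)) a).
    by exists i.
  by exists 0%N.
move=> /choice[ix ixP].
exists (fun a => col (F (ix a) a)) => a b.
set Y := \bigcup_(i in I) _ in ixP *.
move=> ab.
suff [->|[Ya Yb iab Fab]] : a = b \/ [/\ Y a, Y b, ix a = ix b &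
    chain P col setT ta (F (ix a) a) (F (ix a) b)].
    exact: (scale_refl SP).
  have [Ia Pa] := ixP _ Ya; have [Ib Pb] := ixP _ Yb; rewrite -iab in Pb.
  by have [+ _] := FP _ _ _ Ia Pa Pb _ sg0; apply; exact: colP.
elim: ab => [|y x [Yy Yx colyx yx] _ IH]; first by left.
have [Iy Py] := ixP _ Yy; have [Ix Px] := ixP _ Yx.
have iyx : ix y = ix x.
  apply: Isep => //; rewrite (_ : s - 2 * C = s - C - C); last by lra.
  apply: (scale_trans SP).
    by apply: (scale_trans SP Py); apply: (scale_mono SP _ yx); lra.
  by apply: (scale_sym SP); apply: (scale_mono SP _ Px); lra.
have lk : link P col setT ta (F (ix y) y) (F (ix y) x).
  split=> //; first by rewrite colyx iyx.
  rewrite -iyx in Px; rewrite -addrA in yx.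
  have [_ H] := FP _ _ _ Iy Py Px (ta + D) ltac:(lra).
  by have := H yx; rewrite addrK.
right; case: IH => [->|[Ya _ iay ay]]; first by split=> //; exact: chain_link.
split=> //; first by rewrite iay.
by apply: rtn1_trans ay; rewrite iay.
Qed.

(** Every ball of scale [0] is the whole space, so the size of an [s]-separated
    family is bounded; a family of largest size is a net. *)
Lemma doubling_net s : doubling -> 0 <= s ->
  (forall a b, P 0 a b) -> (exists z : Z, True) ->
  exists m (z : nat -> Z), (forall i j, (i < j < m)%N -> ~ P s (z i) (z j)) /\
    forall w, exists2 i, (i < m)%N & P s (z i) w.
Proof.
move=> dbl s0 P0 [z0 _].
have [N NP] := dbl s s0.
pose good m := `[< exists z : nat -> Z, forall i j, (i < j < m)%N -> ~ P s (z i) (z j) >].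
have g0 : exists m, good m.
  by exists 0%N; apply/asboolP; exists (fun=> z0) => i j; rewrite ltn0 andbF.
have gN m : good m -> (m <= N)%N.
  move=> /asboolP[z zP]; apply: (NP s z0 m z s0 zP) => i _; rewrite subrr.
  exact: P0.
have [m /asboolP[z zP] mmax] := ex_maxnP g0 gN.
exists m, z; split=> // w; apply: contrapT => H.
suff /mmax : good m.+1 by rewrite ltnn.
apply/asboolP; exists (fun i => if (i < m)%N then z i else w) => i j /andP[ij jm].
have im : (i < m)%N by apply: leq_trans ij _.
rewrite im; case: ifP => jm'; first by apply: zP; rewrite ij.
by move=> Pw; apply: H; exists i.
Qed.

(** The balls of scale [s] around the points of a net are distributed over
    [J.+1] families by a greedy colouring of the graph that joins two centres
    when their balls are not well separated. *)
Theorem colourable_rescale n :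
  doubling -> self_similar -> (forall a b, P 0 a b) ->
  (forall s, exists T, colourable P n setT s T) ->
  exists2 D : R, 0 <= D & forall s, 0 <= s -> colourable P n setT s (s + D).
Proof.
move=> dbl [D D0 FP] P0 W; have C0 := C_ge0.
have [[z0 _]|noZ] := pselect (exists z : Z, True); last first.
  exists 0 => // s _; exists (fun=> ord0) => a b _.
  by exfalso; apply: noZ; exists a.
have [J JP] := dbl (2 * C) ltac:(lra).
have [tau tau0 tauP] := @colourable_bigcup n D J.+1 D0 W 0 (lexx 0).
exists tau => // s s0.
have [m [z [zsep zcov]]] := doubling_net dbl s0 P0 (ex_intro _ z0 I).
pose e i j := `[< P (s - 2 * C) (z i) (z j) >].
have [|k [kJ kP]] := @greedy_colouring e J.+1 m.
  move=> i im; set nb := [seq _ <- _ | _]; rewrite ltnS.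
  have nbP j : j \in nb -> (j < i)%N /\ P (s - 2 * C) (z j) (z i).
    by rewrite mem_filter mem_iota /= add0n => /andP[/asboolP ? ?].
  have nbs : sorted ltn nb by apply: sorted_filter (iota_ltn_sorted _ _); exact: ltn_trans.
  apply: (JP s (z i) (size nb) (fun q => z (nth 0%N nb q)) s0).
    move=> p q /andP[pq qn]; apply: zsep; apply/andP; split.
      by apply: (sorted_ltn_nth ltn_trans) => //; rewrite inE ?(ltn_trans pq).
    have [qi _] := nbP _ (mem_nth 0%N qn).
    exact: ltn_trans qi im.
  move=> p pn; apply: (scale_sym SP).
  by have [_] := nbP _ (mem_nth 0%N pn).
have [F FF] := choice (fun i => FP s (z i) s0).
have := tauP s (fun c => \bigcup_(i in [set i | (i < m)%N /\ k i = c]) P s (z i)).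
rewrite (_ : \bigcup_(a < J.+1) _ = setT) ?addr0; first apply.
  move=> c sg ta sg0 ta0; apply: colourable_separated_balls D0 sg0 ta0 _ _.
    by move=> i a b _; exact: FF.
  move=> i j [im kic] [jm kjc] Pij; apply: contrapT => /eqP.
  rewrite neq_ltn => /orP[ij|ji].
    by apply: (kP j i); rewrite ?ij ?kic ?kjc//; exact/asboolP.
  apply: (kP i j); rewrite ?ji ?kic ?kjc//; apply/asboolP.
  exact: (scale_sym SP).
apply/seteqP; split=> // w _; have [i im Pw] := zcov w.
by exists (k i); [exact: kJ|exists i].
Qed.

End SelfSimilar.

(** * Rays in CAT(0) spaces *)

Section ComparisonTriangles.
Context {R : realType}.

Lemma comparison_triangle (a b c : R) : 0 <= a -> 0 <= b -> 0 <= c ->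
  a <= b + c -> b <= a + c -> c <= a + b ->
  exists p q r : R * R,
    [/\ eucl_dist p q = a, eucl_dist p r = b & eucl_dist q r = c].
Proof.
move=> a0 b0 c0 abc bac cab.
have sq (x y : R) : 0 <= y -> x = y ^+ 2 -> Num.sqrt x = y.
  by move=> y0 ->; rewrite sqrtr_sqr ger0_norm.
have [az|an] := eqVneq a 0.
  exists (0, 0), (0, 0), (b, 0); rewrite /eucl_dist /=.
  have bc : b = c by apply/eqP; rewrite eq_le; apply/andP; split; lra.
  by split; apply: sq => //; rewrite ?az -?bc; ring.
have a1 : 0 < a by rewrite lt_def an.
(* The third vertex is [(v, w)], with [v] given by the law of cosines. *)
pose v := (a ^+ 2 + b ^+ 2 - c ^+ 2) / (2 * a).
have vE : v * (2 * a) = a ^+ 2 + b ^+ 2 - c ^+ 2 by rewrite mulfVK// mulf_neq0.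
have vb : v ^+ 2 <= b ^+ 2.
  rewrite -(ler_pM2r (_ : 0 < (2 * a) ^+ 2)); last by rewrite exprn_gt0// mulr_gt0.
  rewrite -exprMn vE -subr_ge0.
  (* Heron's formula: the difference is sixteen times the squared area. *)
  rewrite (_ : _ - _ = (a + b + c) * (a + b - c) * (c + (a - b)) * (c - (a - b))); last by ring.
  by repeat apply: mulr_ge0; lra.
exists (0, 0), (a, 0), (v, Num.sqrt (b ^+ 2 - v ^+ 2)); rewrite /eucl_dist /=.
have wE : Num.sqrt (b ^+ 2 - v ^+ 2) ^+ 2 = b ^+ 2 - v ^+ 2.
  by rewrite sqr_sqrtr// subr_ge0.
split; apply: sq => //; first by ring.
  by rewrite !sub0r !sqrrN wE; ring.
rewrite sub0r sqrrN wE (_ : _ + _ = a ^+ 2 + b ^+ 2 - v * (2 * a)); last by ring.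
by rewrite vE; ring.
Qed.

Lemma eucl_dist_homothety (a : R) (p q r : R * R) : 0 <= a ->
  eucl_dist (affine_point a p q) (affine_point a p r) = a * eucl_dist q r.
Proof.
move=> a0; rewrite /eucl_dist /= -[in RHS](ger0_norm a0) -sqrtr_sqr -sqrtrM ?sqr_ge0//.
by congr Num.sqrt; ring.
Qed.

End ComparisonTriangles.

Lemma fmap_ultra (S T : Type) (f : S -> T) (U : set_system S) :
  UltraFilter U -> UltraFilter (f @ U).
Proof.
move=> UU; split=> [|G GG fG]; first exact: fmap_proper_filter.
apply/seteqP; split=> // A GA.
have [//|nA] := in_ultra_setVsetC (f @^-1` A) UU.
by have [x []] := filter_ex (filterI GA (fG (~` A) nA)).
Qed.

Section Cat0.
Context {R : realType} {X : metricType R}.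
Implicit Types (p q r x y : X) (c g h : R -> X) (s t a : R).

Lemma segment_rev c p q : geodesic_segment c p q ->
  geodesic_segment (fun s => c (mdist p q - s)) q p.
Proof.
case=> cp cq cd; rewrite /geodesic_segment (metric_sym q p); split.
- by rewrite subr0.
- by rewrite subrr.
- move=> s t /andP[s0 s1] /andP[t0 t1]; rewrite cd; first by rewrite distrC; congr `|_|; ring.
  + by apply/andP; split; lra.
  + by apply/andP; split; lra.
Qed.

Lemma segment_dist_start c p q t : geodesic_segment c p q -> 0 <= t <= mdist p q ->
  mdist p (c t) = t.
Proof.
move=> [cp _ cd] /andP[t0 t1]; rewrite -{1}cp cd; last 2 first.
- by rewrite lexx mdist_ge0.
- by rewrite t0.
by rewrite sub0r normrN ger0_norm.
Qed.

Lemma ray_segment g t : geodesic_ray g -> 0 <= t -> geodesic_segment g (g 0) (g t).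
Proof.
move=> gg t0; have gt : mdist (g 0) (g t) = t.
  by rewrite gg// sub0r normrN ger0_norm.
rewrite /geodesic_segment gt; split=> // u v /andP[u0 _] /andP[v0 _].
exact: gg.
Qed.

Lemma ray_dist0 g t : geodesic_ray g -> 0 <= t -> mdist (g 0) (g t) = t.
Proof. by move=> gg t0; rewrite gg// sub0r normrN ger0_norm. Qed.

Hypothesis X0 : cat0 X.

Lemma cat0_convex c1 c2 p q r a : geodesic_segment c1 p q ->
  geodesic_segment c2 p r -> 0 <= a <= 1 ->
  mdist (c1 (a * mdist p q)) (c2 (a * mdist p r)) <= a * mdist q r.
Proof.
move=> s1 s2 a01; have [c3 s3] := X0.1 q r.
have [p' [q' [r' [pq pr qr]]]] := comparison_triangle
  (mdist_ge0 p q) (mdist_ge0 p r) (mdist_ge0 q r)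
  ltac:(by rewrite (metric_sym q r); exact: metric_triangle)
  (metric_triangle p q r)
  ltac:(by rewrite (metric_sym p q); exact: metric_triangle).
have := X0.2 p q r c1 c2 c3 p' q' r' s1 s2 s3 pq pr qr a a a01 a01.
by case/andP: a01 => a0 _; rewrite eucl_dist_homothety// qr.
Qed.

Lemma ray_dist_convex g h s t : geodesic_ray g -> geodesic_ray h -> g 0 = h 0 ->
  0 <= s <= t -> 0 < t -> mdist (g s) (h s) <= s / t * mdist (g t) (h t).
Proof.
move=> gg hh gh0 /andP[s0 st] t0.
have sg := ray_segment gg (ltW t0); have sh := ray_segment hh (ltW t0).
rewrite -gh0 in sh.
have st01 : 0 <= s / t <= 1 by rewrite divr_ge0 ?(ltW t0)//= ler_pdivrMr// mul1r.
have := cat0_convex sg sh st01.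
have ht : mdist (g 0) (h t) = t by rewrite gh0 ray_dist0// ltW.
by rewrite ht ray_dist0 ?(ltW t0)// divfK// gt_eqF.
Qed.

Lemma ray_dist_le g h s t : geodesic_ray g -> geodesic_ray h -> g 0 = h 0 ->
  0 <= s <= t -> mdist (g s) (h s) <= mdist (g t) (h t).
Proof.
move=> gg hh gh0 /andP[s0 st]; have [t0|t0] := leP t 0.
  have -> : s = t by apply/eqP; rewrite eq_le st; apply: le_trans t0 _.
  by [].
apply: le_trans (ray_dist_convex gg hh gh0 _ t0) _; first by rewrite s0.
by rewrite ler_piMl ?mdist_ge0// ler_pdivrMr// mul1r.
Qed.

(** Compare points at equal proportions of the two sides issued from [g n]: they
    are at distance at most [mdist x (g 0)], and passing from proportions to arc
    length costs the same amount once more. *)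
Lemma segment_to_ray_close g c x n t : geodesic_ray g ->
  geodesic_segment c x (g n) -> 0 < n -> 0 <= t <= n -> t <= mdist x (g n) ->
  mdist (c t) (g t) <= 2 * mdist x (g 0).
Proof.
move=> gg sc n0 /andP[t0 tn] tl; set l := mdist x (g n) in tl *; set D := mdist x (g 0).
have gn := ray_dist0 gg (ltW n0).
have sg := ray_segment gg (ltW n0).
have a01 : 0 <= 1 - t / n <= 1.
  by rewrite subr_ge0 ler_pdivrMr// mul1r tn /= lerBlDr lerDl divr_ge0// ltW.
have := cat0_convex (segment_rev sc) (segment_rev sg) a01.
rewrite (metric_sym (g n) x) (metric_sym (g n)) gn -/l -/D.
have -> : n - (1 - t / n) * n = t by field; rewrite gt_eqF.
have -> : l - (1 - t / n) * l = t / n * l by ring.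
move=> H1.
have lnD : `|l - n| <= D.
  rewrite ler_norml; have := metric_triangle (g 0) x (g n); rewrite gn -/l (metric_sym _ x) -/D => ?.
  have := metric_triangle x (g 0) (g n); rewrite gn -/l -/D => ?.
  by apply/andP; split; lra.
have tn01 : 0 <= t / n <= 1 by rewrite divr_ge0 ?(ltW n0)//= ler_pdivrMr// mul1r.
have l0 : 0 <= l := mdist_ge0 _ _.
have H2 : mdist (c t) (c (t / n * l)) <= D.
  case: sc => _ _ ->; last 2 first.
  - by rewrite t0.
  - by case/andP: tn01 => *; rewrite mulr_ge0//= -/l ler_piMl.
  have -> : t - t / n * l = t / n * (n - l) by field; rewrite gt_eqF.
  case/andP: tn01 => ? ?; rewrite normrM distrC (ger0_norm (x := t / n))//.
  by apply: le_trans lnD; rewrite ler_piMl.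
apply: le_trans (metric_triangle _ (c (t / n * l)) _) _.
rewrite mulr_natl mulr2n; apply: lerD => //; apply: le_trans H1 _.
by case/andP: a01 => *; rewrite ler_piMl// mdist_ge0.
Qed.

(** The bound must not depend on how far apart the rays drift.  For large [n],
    the segment from [g 0] to [h n] is within [2 * mdist (g 0) (h 0)] of [h] by
    [segment_to_ray_close], and arbitrarily close to [g] at time [t] by
    convexity. *)
Lemma asymptotic_rays_le g h t : geodesic_ray g -> geodesic_ray h ->
  asymptotic g h -> 0 <= t -> mdist (g t) (h t) <= 2 * mdist (g 0) (h 0).
Proof.
move=> gg hh [K gh] t0; set D := mdist (g 0) (h 0).
have D0 : 0 <= D := mdist_ge0 _ _.
have K0 : 0 <= K by apply: le_trans (mdist_ge0 _ _) (gh 0 (lexx _)).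
apply/ler_addgt0Pr => e e0.
(* [n] is so large that [t / l * (D + K) <= e] for the length [l] of the segment. *)
pose n := t + D + 1 + t * (D + K) / e.
have te0 : 0 <= t * (D + K) / e by rewrite divr_ge0 ?(ltW e0)// mulr_ge0// addr_ge0.
have n0 : 0 < n by rewrite /n; lra.
have [c sc] := X0.1 (g 0) (h n).
set l := mdist (g 0) (h n) in sc.
have lnD : `|l - n| <= D.
  rewrite ler_norml; have := metric_triangle (h 0) (g 0) (h n).
  rewrite ray_dist0 ?(ltW n0)// (metric_sym (h 0)) -/D -/l => ?.
  have := metric_triangle (g 0) (h 0) (h n); rewrite ray_dist0 ?(ltW n0)// -/l -/D => ?.
  by apply/andP; split; lra.
have /andP[nD Dn] : - D <= l - n <= D by rewrite -ler_norml.
have tl : t + 1 + t * (D + K) / e <= l by rewrite /n in nD *; lra.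
have l0 : 0 < l by lra.
have H1 : mdist (c t) (h t) <= 2 * D.
  by apply: (segment_to_ray_close hh sc n0); rewrite -/l ?t0 /n /=; lra.
have H2 : mdist (g t) (c t) <= e.
  have sg := ray_segment gg (ltW l0).
  have tl01 : 0 <= t / l <= 1 by rewrite divr_ge0 ?(ltW l0)//= ler_pdivrMr// mul1r; lra.
  have := cat0_convex sg sc tl01.
  rewrite ray_dist0 ?(ltW l0)// -/l divfK ?gt_eqF// => H.
  apply: le_trans H _.
  have glK : mdist (g l) (h n) <= D + K.
    apply: le_trans (metric_triangle _ (g n) _) _.
    by rewrite gg ?(ltW l0) ?(ltW n0)// lerD// gh// ltW.
  apply: le_trans (_ : t / l * (D + K) <= _).
    by apply: ler_wpM2l => //; case/andP: tl01.
  rewrite mulrAC ler_pdivrMr// -ler_pdivrMl// mulrC.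
  by apply: le_trans tl; lra.
by apply: le_trans (metric_triangle _ (c t) _) _; lra.
Qed.

Lemma asymptotic_rays_eq g h t : geodesic_ray g -> geodesic_ray h ->
  asymptotic g h -> g 0 = h 0 -> 0 <= t -> g t = h t.
Proof.
move=> gg hh gh gh0 t0; apply: mdist_positivity; apply/eqP.
rewrite eq_le mdist_ge0 andbT.
by have := asymptotic_rays_le gg hh gh t0; rewrite gh0 mdistxx mulr0.
Qed.

Hypothesis Xproper : proper_space X.

(** The segments from [x0] to [h n] stay in compact balls, so they converge
    pointwise along an ultrafilter; the limit is a ray, and it remains close to
    [h] by [segment_to_ray_close]. *)
Lemma asymptotic_ray_from h x0 : geodesic_ray h ->
  exists g, [/\ geodesic_ray g, g 0 = x0 & asymptotic h g].
Proof.
move=> hh; set D := mdist x0 (h 0).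
have [c cP] := choice (fun n : nat => X0.1 x0 (h n%:R)).
have [U [UU Uoo]] := @ultraFilterLemma nat \oo _.
have lnD (n : nat) : n%:R - D <= mdist x0 (h n%:R).
  have := metric_triangle (h 0) x0 (h n%:R).
  by rewrite ray_dist0// (metric_sym _ x0) -/D; lra.
have nlarge t : U [set n : nat | t <= n%:R].
  apply: Uoo; have := @nbhs_infty_ger R t; exact.
have cd t n : 0 <= t -> t + D <= n%:R -> mdist x0 (c n t) = t.
  move=> t0 tn; apply: segment_dist_start (cP n) _; rewrite t0 /=.
  by have := lnD n; lra.
have lim t : exists p, 0 <= t -> forall e, 0 < e -> U [set n | mdist p (c n t) < e].
  have [t0|t0] := leP 0 t; last by exists x0.
  have [p [_ pP]] : [set p | mdist x0 p <= t] `&` [set p | c^~ t @ U --> p] !=set0.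
    have := Xproper (x := x0) (r := t); rewrite compact_ultra => /(_ (c^~ t @ U) (fmap_ultra _ UU)); apply.
    suff : U [set n | mdist x0 (c n t) <= t] by [].
    by apply: filterS (nlarge (t + D)) => n /= tn; rewrite cd.
  exists p => _ e e0; have := pP _ (nbhsx_ballx p e e0).
  by rewrite /= ballEmdist.
have [g gP] := choice lim.
exists g; split.
- move=> s t s0 t0; apply/eqP; rewrite eq_le; apply/andP; split.
  + apply/ler_addgt0Pr => e e0; have e20 : 0 < e / 2 by lra.
    have [n [[/= ns nt] [Ns Nt]]] := filter_ex (filterI
      (filterI (gP s s0 _ e20) (gP t t0 _ e20))
      (filterI (nlarge (s + D)) (nlarge (t + D)))).
    have := metric_triangle (g s) (c n s) (g t).
    have := metric_triangle (c n s) (c n t) (g t).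
    case: (cP n) => _ _ ->; [|by rewrite s0/=; have := lnD n; lra|by rewrite t0/=; have := lnD n; lra].
    by rewrite (metric_sym (c n t)); lra.
  + apply/ler_addgt0Pr => e e0; have e20 : 0 < e / 2 by lra.
    have [n [[/= ns nt] [Ns Nt]]] := filter_ex (filterI
      (filterI (gP s s0 _ e20) (gP t t0 _ e20))
      (filterI (nlarge (s + D)) (nlarge (t + D)))).
    have := metric_triangle (c n s) (g s) (c n t).
    have := metric_triangle (g s) (g t) (c n t).
    case: (cP n) => _ _ ->; [|by rewrite s0/=; have := lnD n; lra|by rewrite t0/=; have := lnD n; lra].
    by rewrite (metric_sym (c n s)); lra.
- apply: mdist_positivity; apply/eqP; rewrite eq_le mdist_ge0 andbT.
  apply/ler_addgt0Pr => e e0; rewrite add0r.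
  have [n /= ns] := filter_ex (gP 0 (lexx _) _ e0).
  by case: (cP n) ns => -> _ _ /ltW.
- exists (2 * D) => t t0; apply/ler_addgt0Pr => e e0.
  have [n [/= nt [Nt N0]]] := filter_ex (filterI (gP t t0 _ e0)
     (filterI (nlarge (t + D)) (nlarge (t + 1)))).
  have H : mdist (c n t) (h t) <= 2 * D.
    by apply: segment_to_ray_close (cP n) _ _ _ => //; have := lnD n; lra.
  have := metric_triangle (g t) (c n t) (h t).
  by rewrite (metric_sym (h t)); lra.
Qed.

End Cat0.

(** * The boundary is self-similar and doubling *)

Section Separation.
Context {R : realType} {X : metricType R}.

(** Otherwise the complements of finite unions of balls generate a filter on
    [K], and any of its cluster points lies in a ball of radius [1 / 2] around
    itself. *)
Lemma compact_net (K : set X) : compact K ->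
  exists D : seq X, forall y, K y -> exists2 c, c \in D & mdist c y < 1 / 2.
Proof.
move=> Kc; pose B (D : seq X) := K `&` [set y | forall c, c \in D -> 1 / 2 <= mdist c y].
apply: contrapT => noD.
have FF : ProperFilter (filter_from setT B).
  apply: filter_from_proper => [|D _].
    apply: filter_from_filter; first by exists [::].
    move=> D D' _ _; exists (D ++ D') => // y [Ky yD].
    by split; split=> // c cD; apply: yD; rewrite mem_cat cD ?orbT.
  apply: contrapT => BD; apply: noD; exists D => y Ky.
  apply: contrapT => yD; apply: BD; exists y; split=> // c cD.
  by rewrite leNgt; apply/negP => cy; apply: yD; exists c.
have [|p [_ pF]] := Kc _ FF; first by exists [::] => // y [].
have half0 : 0 < 1 / 2 :> R by lra.
have Bp : filter_from setT B (B [:: p]) by exists [:: p].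
have [y [[_ /(_ p)]]] := pF _ _ Bp (nbhsx_ballx p _ half0).
by rewrite ballEmdist inE eqxx => /(_ isT) /= ?; rewrite ltNge => /negP.
Qed.

Lemma compact_bounded_from (x0 : X) (K : set X) : compact K ->
  exists M : R, forall y, K y -> mdist x0 y <= M.
Proof.
move=> /compact_net[D DK].
have [M MP] : exists M : R, forall c, c \in D -> mdist x0 c <= M.
  elim: D {DK} => [|c D [M MP]]; first by exists 0.
  exists (Num.max M (mdist x0 c)) => e; rewrite inE le_max => /orP[/eqP ->|eD].
    by rewrite lexx orbT.
  by rewrite MP.
exists (M + 1 / 2) => y /DK[c /MP cM cy].
by have := metric_triangle x0 c y; lra.
Qed.

Lemma compact_separated (K : set X) : compact K -> exists J : nat,
  forall (m : nat) (x : nat -> X), (forall i, (i < m)%N -> K (x i)) ->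
    (forall i j, (i < j < m)%N -> 1 < mdist (x i) (x j)) -> (m <= J)%N.
Proof.
move=> /compact_net[D DK].
exists (size D) => m x xK xsep.
have cP i : exists c, (i < m)%N -> c \in D /\ mdist c (x i) < 1 / 2.
  have [im|_] := boolP (i < m)%N; last by exists (x i).
  by have [c cD cx] := DK _ (xK i im); exists c.
have [c {}cP] := choice cP.
rewrite -(size_iota 0 m) -(size_map c); apply: uniq_leq_size; last first.
  by move=> y /mapP[i]; rewrite mem_iota /= add0n => im ->; case: (cP i im).
have sep i j : (i < j < m)%N -> c i <> c j.
  move=> ijm cij; have := xsep i j ijm; case/andP: ijm => ij jm.
  have [_ ci] := cP i (ltn_trans ij jm); have [_ cj] := cP j jm.
  have := metric_triangle (x i) (c i) (x j).
  by rewrite -cij in cj; rewrite (metric_sym (x i) (c i)); lra.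
rewrite map_inj_in_uniq ?iota_uniq// => i j; rewrite !mem_iota !add0n /= => im jm cij.
have [ij|ji|//] := ltngtP i j.
- by have := sep i j; rewrite ij jm => /(_ isT) /(_ cij).
- by have := sep j i; rewrite ji im => /(_ isT) /(_ (esym cij)).
Qed.

(** The isometry must be built from two translates, one that covers [x] and one
    that covers [x0]. *)
Lemma cobounded_recentre (x0 : X) : cobounded X ->
  exists rho : R, forall x, exists2 f : X -> X, Defs.isometry f & mdist (f x) x0 <= rho.
Proof.
move=> [B [[M BM] Bcov]]; exists M => x.
have [f1 [[f1b f1d] [b1 Bb1 <-]]] := Bcov x.
have [f2 [[f2b f2d] [b2 Bb2 <-]]] := Bcov x0.
have [g1 g1K f1K] := f1b; exists (f2 \o g1); last first.
  by rewrite /= g1K f2d; exact: BM.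
split; first by apply: bij_comp => //; exists f1.
by move=> y z; rewrite /= f2d -f1d !f1K.
Qed.

End Separation.

Section BoundaryRays.
Context {R : realType} {X : metricType R}.
Variables (x0 : X) (delta : R).
Hypothesis X0 : cat0 X.
Hypothesis Xproper : proper_space X.
Hypothesis Xhyp : hyperbolic (@mdist R X) delta.
Implicit Types (a b c : boundary X) (g h : R -> X) (s t : R).

Lemma asymptotic_sym g h : asymptotic g h -> asymptotic h g.
Proof. by move=> [K gh]; exists K => t t0; rewrite metric_sym; exact: gh. Qed.

Lemma asymptotic_trans g h k : asymptotic g h -> asymptotic h k -> asymptotic g k.
Proof.
move=> [K gh] [L hk]; exists (K + L) => t t0.
by apply: le_trans (metric_triangle _ (h t) _) _; rewrite lerD ?gh ?hk.
Qed.

(** The representative of [a] issued from [x0], which is unique on nonnegative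
    times by [asymptotic_rays_eq]. *)
Definition boundary_ray a : R -> X :=
  xget (fun=> x0) [set g | sval a g /\ g 0 = x0].

Lemma boundary_class a : exists2 g, geodesic_ray g & sval a = ray_class g.
Proof. exact: svalP a. Qed.

Lemma boundary_rayP a : [/\ geodesic_ray (boundary_ray a),
  boundary_ray a 0 = x0 & sval a (boundary_ray a)].
Proof.
have [g gg ag] := boundary_class a.
suff [ar ar0] : [set g | sval a g /\ g 0 = x0] (boundary_ray a).
  by split=> //; move: ar; rewrite ag => -[].
rewrite /boundary_ray; case: xgetP => [_ -> //|noray].
have [h [hh h0 gh]] := asymptotic_ray_from X0 Xproper x0 gg.
by exfalso; apply: (noray h); rewrite /= ag.
Qed.

Lemma boundary_ray_asymptotic a h : sval a h -> geodesic_ray h /\ asymptotic (boundary_ray a) h.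
Proof.
have [_ _] := boundary_rayP a; have [g gg ->] := boundary_class a.
by move=> [_ ga] [hh gh]; split=> //; exact: asymptotic_trans (asymptotic_sym ga) gh.
Qed.

Lemma boundary_ray_inj a b : asymptotic (boundary_ray a) (boundary_ray b) -> a = b.
Proof.
move=> ab; apply: eq_sig_hprop; first by move=> ? ? ?; exact: Prop_irrelevance.
have [_ _ +] := boundary_rayP a; have [_ _ +] := boundary_rayP b.
have [g gg ->] := boundary_class a; have [h hh ->] := boundary_class b.
move=> [_ hb] [_ ga].
have gh : asymptotic g h := asymptotic_trans ga (asymptotic_trans ab (asymptotic_sym hb)).
apply/seteqP; split=> k [kk gk]; split=> //.
  exact: asymptotic_trans (asymptotic_sym gh) gk.
exact: asymptotic_trans gh gk.
Qed.

Definition ray_dist t a b : R := mdist (boundary_ray a t) (boundary_ray b t).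

Lemma hyperbolic_delta_ge0 : 0 <= delta.
Proof.
by have := Xhyp x0 x0 x0 x0; rewrite /gromov_product mdistxx minxx; lra.
Qed.

Lemma ray_gromov_product g s t : geodesic_ray g -> 0 <= s -> 0 <= t ->
  gromov_product mdist (g 0) (g s) (g t) = Num.min s t.
Proof.
move=> gg s0 t0; rewrite /gromov_product !(metric_sym _ (g 0)) !ray_dist0// gg//.
case: leP => st; [rewrite distrC ger0_norm|rewrite ger0_norm]; lra.
Qed.

(** The Gromov product of [g t] and [h t] is [t - mdist (g t) (h t) / 2 >= s], so
    by hyperbolicity that of [g s] and [h s] is at least [s - 2 * delta]. *)
Lemma rays_fellow_travel g h s t : geodesic_ray g -> geodesic_ray h -> g 0 = h 0 ->
  0 <= s <= t -> s <= t - mdist (g t) (h t) / 2 -> mdist (g s) (h s) <= 4 * delta.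
Proof.
move=> gg hh gh0 /andP[s0 st] sgh; have t0 := le_trans s0 st.
have H1 := Xhyp (g s) (g t) (h s) (g 0); have H2 := Xhyp (g t) (h t) (h s) (g 0).
rewrite ray_gromov_product// (min_l st) in H1.
have hts : gromov_product mdist (g 0) (h t) (h s) = s.
  by rewrite gh0 ray_gromov_product// min_r.
have ght : gromov_product mdist (g 0) (g t) (h t) = t - mdist (g t) (h t) / 2.
  rewrite /gromov_product (metric_sym _ (g 0)) ray_dist0// (metric_sym _ (g 0)).
  by rewrite gh0 ray_dist0//; lra.
rewrite hts ght min_r// in H2.
have d0 := hyperbolic_delta_ge0.
have Hmin : s - delta <= Num.min s (gromov_product mdist (g 0) (g t) (h s)).
  by rewrite le_min; apply/andP; split; lra.
have : s - 2 * delta <= gromov_product mdist (g 0) (g s) (h s) by lra.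
rewrite /gromov_product (metric_sym _ (g 0)) ray_dist0// (metric_sym _ (g 0)).
by rewrite gh0 ray_dist0//; lra.
Qed.

(** Any bound above the constant [4 * delta] of [rays_fellow_travel] would do; it
    has to be positive even for a tree, since it will be compared with [A]. *)
Definition agree_bound : R := 4 * delta + 1.
Local Notation H := agree_bound.

(** Truncating the time at [0] makes the relation hold for all [t <= 0], which
    avoids side conditions when constants are subtracted from a time. *)
Definition agree t a b : Prop := ray_dist (Num.max t 0) a b <= H.

Lemma agree_bound_ge1 : 1 <= H.
Proof. by rewrite /H; have := hyperbolic_delta_ge0; lra. Qed.

Lemma agreeE t a b : 0 <= t -> agree t a b = (ray_dist t a b <= H).
Proof. by move=> t0; rewrite /agree max_l. Qed.

Lemma ray_dist00 a b : ray_dist 0 a b = 0.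
Proof.
rewrite /ray_dist; have [_ -> _] := boundary_rayP a; have [_ -> _] := boundary_rayP b.
exact: mdistxx.
Qed.

Lemma agree_le0 t a b : t <= 0 -> agree t a b.
Proof.
move=> t0; rewrite /agree max_r// ray_dist00.
by apply: le_trans agree_bound_ge1.
Qed.

Lemma agree_of_ray_dist t M a b : 0 <= t -> ray_dist t a b <= M -> agree (t - M / 2) a b.
Proof.
move=> t0 abM; have [?|tM] := leP (t - M / 2) 0; first exact: agree_le0.
have M0 : 0 <= M by apply: le_trans abM; exact: mdist_ge0.
have [ga a0 _] := boundary_rayP a; have [gb b0 _] := boundary_rayP b.
rewrite agreeE; last exact: ltW.
apply: (@le_trans _ _ (4 * delta)); last by rewrite /H; lra.
apply: (@rays_fellow_travel _ _ _ t) => //; rewrite ?a0 ?b0//.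
  by rewrite ltW//=; lra.
by rewrite -/(ray_dist t a b); lra.
Qed.

Lemma ray_dist_of_agree s t a b : agree s a b -> s <= t -> 0 <= t ->
  ray_dist t a b <= H + 2 * (t - s).
Proof.
move=> sab st t0; set s' := Num.max s 0.
have s'0 : 0 <= s' by rewrite le_max lexx orbT.
have ss' : s <= s' by rewrite le_max lexx.
have s't : s' <= t by rewrite ge_max st.
have [ga a0 _] := boundary_rayP a; have [gb b0 _] := boundary_rayP b.
have gat : mdist (boundary_ray a t) (boundary_ray a s') = t - s'.
  by rewrite ga// ger0_norm// subr_ge0.
have gbt : mdist (boundary_ray b s') (boundary_ray b t) = t - s'.
  by rewrite gb// distrC ger0_norm// subr_ge0.
have := metric_triangle (boundary_ray a t) (boundary_ray a s') (boundary_ray b t).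
have := metric_triangle (boundary_ray a s') (boundary_ray b s') (boundary_ray b t).
move: sab; rewrite /agree -/s' /ray_dist; lra.
Qed.

Lemma agree_scale_relation : scale_relation agree H.
Proof.
have H1 := agree_bound_ge1; split.
- lra.
- by move=> t a; rewrite /agree /ray_dist mdistxx; lra.
- by move=> t a b; rewrite /agree /ray_dist metric_sym.
- move=> s t a b st; apply: le_trans.
  have [ga a0 _] := boundary_rayP a; have [gb b0 _] := boundary_rayP b.
  apply: (ray_dist_le X0 ga gb); first by rewrite a0.
  rewrite le_max lexx orbT /= ge_max !le_max st lexx /= orbT//.
- move=> t a b c ab bc; have [tH|tH] := leP t H; first by apply: agree_le0; lra.
  have t0 : 0 <= t by lra.
  have -> : t - H = t - (2 * H) / 2 by field.
  apply: agree_of_ray_dist => //; move: ab bc; rewrite !agreeE// => ab bc.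
  apply: le_trans (metric_triangle _ (boundary_ray b t) _) _.
  by move: ab bc; rewrite /ray_dist; lra.
Qed.

(** Two boundary points are separated at scale [s] when their rays are more than
    [1] apart at time [s].  Those in a ball of scale [s - D] are at bounded
    distance from each other at that time; an isometry brings them into a fixed
    compact ball. *)
Lemma agree_doubling : cobounded X -> doubling agree.
Proof.
move=> /(cobounded_recentre x0)[rho rhoP] D D0.
have [J JP] := compact_separated (Xproper (x := x0) (r := H + 2 * D + rho)).
exists J => s w m z s0 zsep zw.
have [f [_ fd] fw] := rhoP (boundary_ray w s).
apply: (JP m (fun i => f (boundary_ray (z i) s))) => [i im /=|i j ijm].
  have sDs : s - D <= s by lra.
  have := ray_dist_of_agree (zw i im) sDs s0.
  have := metric_triangle x0 (f (boundary_ray w s)) (f (boundary_ray (z i) s)).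
  by rewrite fd (metric_sym x0 (f (boundary_ray w s))) /ray_dist; lra.
rewrite fd; apply: le_lt_trans agree_bound_ge1 _; rewrite ltNge; apply/negP => zz.
by apply: (zsep i j ijm); rewrite agreeE.
Qed.

Definition boundary_of_ray g (gg : geodesic_ray g) : boundary X :=
  exist _ (ray_class g) (ex_intro2 _ _ g gg erefl).

Lemma isometry_ray f g s : Defs.isometry f -> geodesic_ray g -> 0 <= s ->
  geodesic_ray (fun t => f (g (s + t))).
Proof.
move=> [_ fd] gg s0 u v u0 v0; rewrite fd gg ?addr_ge0//; congr `|_|; ring.
Qed.

(** Choose an isometry [f] that brings the point at time [s] of the ray of [w]
    close to [x0], and send [a] to the class of the image under [f] of its ray
    cut off before time [s].  On the ball of scale [s] around [w] this image
    starts close to [x0], so by [asymptotic_rays_le] it stays close to the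
    representative issued from [x0]. *)
Lemma agree_self_similar : cobounded X -> self_similar agree.
Proof.
move=> /(cobounded_recentre x0)[rho rhoP].
have rho0 : 0 <= rho by have [f _] := rhoP x0; apply: le_trans; exact: mdist_ge0.
have H1 := agree_bound_ge1.
pose E := 4 * (rho + H); exists ((H + E) / 2); first by rewrite /E; lra.
move=> s w s0; have [f fi fw] := rhoP (boundary_ray w s).
have gr a : geodesic_ray (boundary_ray a) by have [] := boundary_rayP a.
pose F a := boundary_of_ray (isometry_ray fi (gr a) s0); exists F.
have Fclose a t : agree s w a -> 0 <= t ->
    mdist (boundary_ray (F a) t) (f (boundary_ray a (s + t))) <= 2 * (rho + H).
  move=> wa t0; have [ga a0 Fa] := boundary_rayP (F a).
  have FF : sval (F a) (fun t => f (boundary_ray a (s + t))).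
    split; first exact: isometry_ray.
    by exists 0 => u u0; rewrite mdistxx.
  have [hh as_h] := boundary_ray_asymptotic FF.
  apply: le_trans (asymptotic_rays_le X0 ga hh as_h t0) _.
  rewrite a0 addr0 ler_pM2l//.
  have := metric_triangle x0 (f (boundary_ray w s)) (f (boundary_ray a s)).
  move: wa; rewrite agreeE// /ray_dist; have [_ ->] := fi.
  by rewrite (metric_sym x0 (f (boundary_ray w s))); lra.
move=> a b wa wb t t0; have st0 : 0 <= s + t by rewrite addr_ge0.
have Fa := Fclose a t wa t0; have Fb := Fclose b t wb t0.
have fd : mdist (f (boundary_ray a (s + t))) (f (boundary_ray b (s + t))) =
    ray_dist (s + t) a b by have [_ ->] := fi.
split=> ab; apply: agree_of_ray_dist => //; move: ab; rewrite agreeE//.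
- have := metric_triangle (f (boundary_ray a (s + t))) (boundary_ray (F a) t) (f (boundary_ray b (s + t))).
  have := metric_triangle (boundary_ray (F a) t) (boundary_ray (F b) t) (f (boundary_ray b (s + t))).
  by rewrite fd (metric_sym (f _) (boundary_ray (F a) t)) /E /ray_dist; lra.
- have := metric_triangle (boundary_ray (F a) t) (f (boundary_ray a (s + t))) (boundary_ray (F b) t).
  have := metric_triangle (f (boundary_ray a (s + t))) (f (boundary_ray b (s + t))) (boundary_ray (F b) t).
  by rewrite fd (metric_sym (f (boundary_ray b (s + t))) (boundary_ray (F b) t)) /E /ray_dist; lra.
Qed.

End BoundaryRays.

(** * Metrics gauged by a scale relation *)

Section Comparison.
Context {R : realType} {Z : Type}.
Variables (P : R -> Z -> Z -> Prop) (C : R).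
Hypothesis SP : scale_relation P C.
Implicit Types (d : Z -> Z -> R) (n : nat).

(** At every small scale [l] there is a time [s] such that [P (s - 2 * C)] forces
    [d a b <= l], and [d a b < c * l] forces [P (s + E)].  The ratio [c] may
    depend on the additive loss [E], but neither depends on [l].  Metrics that
    decay exponentially in the Gromov product have this property, and so do those
    that decay like its inverse. *)
Definition gauged d : Prop := forall E : R, 0 <= E ->
  exists c l0 : R, [/\ 0 < c <= 1, 0 < l0 & forall l, 0 < l <= l0 ->
    exists2 s, 0 <= s & forall a b, (P (s - 2 * C) a b -> d a b <= l) /\
      (d a b < c * l -> P (s + E) a b)].

(** A single cover of small mesh and positive Lebesgue number suffices: nothing is
    claimed here on the size of [T]. *)
Lemma colourable_of_cdim_le d n : gauged d -> cdim_le d n ->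
  forall s, exists T, colourable P n setT s T.
Proof.
move=> dP [c [l0 [/andP[c0 c1] l00 cov]]] s; have C0 := scale_defect_ge0 SP.
have [cg [lg [/andP[cg0 cg1] lg0 gP]]] := dP (Num.max s 0) ltac:(by rewrite le_max lexx orbT).
have [s1 s10 s1P] := gP lg ltac:(by rewrite lg0 lexx).
pose l := Num.min l0 (cg * lg / 2).
have ll0 : l <= l0 by rewrite ge_min lexx.
have llg : l <= cg * lg / 2 by rewrite ge_min lexx orbT.
have cglg : 0 < cg * lg by exact: mulr_gt0.
have lpos : 0 < l by rewrite lt_min l00 divr_gt0.
have [D [Dcov Dord Dmesh Dleb]] := cov l ltac:(by rewrite lpos).
have clpos : 0 < c * l / 2 by rewrite divr_gt0// mulr_gt0.
have [s2 s20 s2P] := gP (Num.min lg (c * l / 2)) ltac:(by rewrite lt_min lg0 clpos ge_min lexx).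
apply: (@colouring_of_cover _ _ _ _ d D n l (c * l) s (s2 - 2 * C) SP) => //.
- exact: mulr_gt0.
- move=> a b dl; have smax : s <= s1 + Num.max s 0.
    have : s <= Num.max s 0 by rewrite le_max lexx.
    by lra.
  apply: (scale_mono SP smax); apply: (s1P a b).2; lra.
- by move=> a b /(s2P a b).1 /le_trans; apply; rewrite ge_min lexx orbT.
Qed.

Lemma cdim_le_of_colourable d n (D : R) : gauged d -> 0 <= D ->
  (forall s, 0 <= s -> colourable P n setT s (s + D)) -> cdim_le d n.
Proof.
move=> dP D0 col; have C0 := scale_defect_ge0 SP.
have [c [l0 [c01 l00 gP]]] := dP (D + C) ltac:(lra).
exists c, l0; split=> // l ll0; have [s s0 sP] := gP l ll0.
have l1 : 0 <= l by case/andP: ll0 => /ltW.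
apply: (cover_of_colouring SP l1 _ (col s s0)); first by lra.
- by move=> a b /(sP a b).1.
- by move=> a b /(sP a b).2; rewrite addrA.
Qed.

Theorem cdim_gauged_eq d d' : doubling P -> self_similar P ->
  (forall a b, P 0 a b) -> gauged d -> gauged d' -> cdim d = cdim d'.
Proof.
move=> dbl sim P0 dP d'P; rewrite /cdim; congr (ereal_inf _).
suff H d1 d2 n : gauged d1 -> gauged d2 -> cdim_le d1 n -> cdim_le d2 n.
  by apply/seteqP; split=> _ [n nd <-]; exists n => //; exact: H nd.
move=> d1P d2P /(colourable_of_cdim_le d1P) col.
have [D D0 colD] := colourable_rescale SP dbl sim P0 col.
exact: cdim_le_of_colourable d2P D0 colD.
Qed.

End Comparison.

(** * The conical metric *)

Section Conical.
Context {R : realType} {X : metricType R}.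
Variables (x0 : X) (delta A : R).
Hypothesis X0 : cat0 X.
Hypothesis Xproper : proper_space X.
Hypothesis Xhyp : hyperbolic (@mdist R X) delta.
Hypothesis A0 : 0 < A.
Implicit Types (a b : boundary X) (s t : R).

Local Notation ray := (boundary_ray x0).
Local Notation rdist := (ray_dist x0).
Local Notation H := (agree_bound delta).
Local Notation agree := (agree x0 delta).

Lemma conical_timeE a b : conical_time x0 A a b = [set t | 0 < t /\ rdist t a b = A].
Proof.
have rayE a' g t : sval a' g -> g 0 = x0 -> 0 < t -> g t = ray a' t.
  move=> ag g0 t0; have [ga' a0 _] := boundary_rayP x0 X0 Xproper a'.
  have [gg as_g] := boundary_ray_asymptotic x0 X0 Xproper ag.
  by apply/esym/(asymptotic_rays_eq X0 ga' gg as_g); rewrite ?a0 ?g0// ltW.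
apply/seteqP; split=> t [t0].
  move=> [g [h [ag bh g0 h0 gh]]]; split=> //.
  by rewrite /ray_dist -(rayE a g)// -(rayE b h).
move=> tA; split=> //; exists (ray a), (ray b).
by have [_ ? ?] := boundary_rayP x0 X0 Xproper a; have [_ ? ?] := boundary_rayP x0 X0 Xproper b.
Qed.

Lemma rdist_scale s t a b : 0 <= s <= t -> 0 < t -> rdist s a b <= s / t * rdist t a b.
Proof.
have [ga a0 _] := boundary_rayP x0 X0 Xproper a.
have [gb b0 _] := boundary_rayP x0 X0 Xproper b.
by apply: ray_dist_convex; rewrite // a0.
Qed.

Lemma rdist_continuous a b : continuous (fun t => rdist (Num.max t 0) a b).
Proof.
have [ga _ _] := boundary_rayP x0 X0 Xproper a.
have [gb _ _] := boundary_rayP x0 X0 Xproper b.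
have max0 (t : R) : 0 <= Num.max t 0 by rewrite le_max lexx orbT.
have maxlip (s t : R) : `|Num.max s 0 - Num.max t 0| <= `|s - t|.
  rewrite ler_norml; have := ler_norm (s - t); have := ler_norm (t - s).
  by rewrite (distrC t s); case: (leP s 0) => ?; case: (leP t 0) => ? ? ?; apply/andP; split; lra.
have lip s t : rdist (Num.max s 0) a b - rdist (Num.max t 0) a b <= 2 * `|s - t|.
  have := metric_triangle (ray a (Num.max s 0)) (ray a (Num.max t 0)) (ray b (Num.max s 0)).
  have := metric_triangle (ray a (Num.max t 0)) (ray b (Num.max t 0)) (ray b (Num.max s 0)).
  by rewrite ga// gb// (distrC (Num.max t 0)) /ray_dist; have := maxlip s t; lra.
move=> t; apply/cvgrPdist_le => e e0; near=> s.
have st : `|t - s| <= e / 2 by near: s; apply: (@cvgr_dist_le _ _ _ (nbhs t)) => //; lra.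
rewrite ler_norml; have := lip s t; have := lip t s; rewrite (distrC s t).
by move=> ? ?; apply/andP; split; lra.
Unshelve. all: by end_near. Qed.

(** The distance between the rays vanishes at time [0], is continuous, and is
    unbounded since the rays are not asymptotic. *)
Lemma conical_time_exists a b : a <> b -> exists t, conical_time x0 A a b t.
Proof.
move=> ab; rewrite conical_timeE.
have [t1 [t10 At1]] : exists t, 0 <= t /\ A < rdist t a b.
  apply: contrapT => nt; apply/ab/(boundary_ray_inj X0 Xproper (x0 := x0)).
  exists A => t t0; rewrite leNgt; apply/negP => At; apply: nt; exists t.
  by split.
have f0 : rdist (Num.max 0 0) a b = 0 by rewrite maxxx ray_dist00.
have ft1 : rdist (Num.max t1 0) a b = rdist t1 a b by rewrite max_l.
have [|t t01 tA] := @IVT R (fun t => rdist (Num.max t 0) a b) 0 t1 A t10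
  (continuous_subspaceT (@rdist_continuous a b)).
  by rewrite f0 ft1 min_l ?max_r ?(ltW A0) ?(ltW At1)// ltW// (lt_trans A0).
have t0 : 0 <= t by move: t01; rewrite in_itv /= => /andP[].
exists t; rewrite max_l// in tA; split=> //.
rewrite lt_def t0 andbT; apply/eqP => tz; move: tA; rewrite tz ray_dist00//.
by move=> Az; have := A0; rewrite -Az ltxx.
Qed.

Lemma conical_dist_self a : conical_dist x0 A a a = 0.
Proof.
suff no t : ~ conical_time x0 A a a t by rewrite /conical_dist xgetPN ?invr0.
rewrite conical_timeE => -[_].
by rewrite /ray_dist mdistxx => Az; have := A0; rewrite -Az ltxx.
Qed.

Lemma conical_dist_spec a b : a <> b -> exists t, [/\ 0 < t, rdist t a b = A &
  conical_dist x0 A a b = t^-1].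
Proof.
move=> /conical_time_exists[t /(xgetI 0)]; rewrite /conical_dist.
set u := xget _ _; rewrite conical_timeE => -[u0 uA].
by exists u.
Qed.

(** If the distance [A] is reached at a time [t] before [s], then convexity gives
    [A <= t / s * agree_bound delta]. *)
Lemma conical_dist_le s a b : 0 < s -> agree s a b ->
  conical_dist x0 A a b <= Num.max 1 (H / A) / s.
Proof.
move=> s0; rewrite agreeE ?(ltW s0)// => sab.
have H0 : 0 < H by apply: lt_le_trans ltr01 _; exact: (agree_bound_ge1 x0 Xhyp).
have [->|/conical_dist_spec[t [t0 tA ->]]] := pselect (a = b).
  by rewrite conical_dist_self divr_ge0 ?(ltW s0)// le_max ler01.
rewrite ler_pdivlMr// mulrC ler_pdivrMr//.
have [st|ts] := leP s t.
  by apply: le_trans st _; rewrite ler_peMl ?(ltW t0)// le_max lexx.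
have := rdist_scale a b (s := t) (t := s); rewrite (ltW t0) (ltW ts) tA => /(_ isT s0) At.
have : A <= t / s * H.
  by apply: le_trans At _; rewrite ler_pM2l// divr_gt0.
rewrite mulrAC ler_pdivlMr// => AtH.
apply: (@le_trans _ _ (H / A * t)); last first.
  by rewrite ler_pM2r// le_max lexx orbT.
by rewrite mulrAC ler_pdivlMr// mulrC mulrC (mulrC s) (mulrC H).
Qed.

Lemma agree_of_conical_dist s a b : 0 < s ->
  conical_dist x0 A a b < Num.min 1 (H / A) / s -> agree s a b.
Proof.
move=> s0; have H0 : 0 < H by apply: lt_le_trans ltr01 _; exact: (agree_bound_ge1 x0 Xhyp).
have [<- _|/conical_dist_spec[t [t0 tA ->]]] := pselect (a = b).
  by rewrite agreeE ?(ltW s0)// /ray_dist mdistxx (ltW H0).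
rewrite ltr_pdivlMr// mulrC ltr_pdivrMr// => sm; rewrite agreeE ?(ltW s0)//.
have st : s <= t.
  by apply/ltW/(lt_le_trans sm); rewrite ler_piMl ?(ltW t0)// ge_min lexx.
apply: le_trans (rdist_scale a b _ t0) _; first by rewrite (ltW s0).
rewrite tA mulrAC ler_pdivrMr//.
have sH : s <= H / A * t.
  by apply/ltW/(lt_le_trans sm); rewrite ler_pM2r// ge_min lexx orbT.
by move: sH; rewrite mulrAC ler_pdivlMr.
Qed.

Lemma conical_dist_gauged : gauged agree H (conical_dist x0 A).
Proof.
move=> E E0; have H1 := agree_bound_ge1 x0 Xhyp.
set K := Num.max 1 (H / A); set k := Num.min 1 (H / A).
have K1 : 1 <= K by rewrite le_max lexx.
have k0 : 0 < k by rewrite lt_min ltr01 divr_gt0//; lra.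
have k1 : k <= 1 by rewrite ge_min lexx.
have KE : 0 < K + E + 2 * H by lra.
exists (k / (K + E + 2 * H)), 1; split=> //.
  by rewrite divr_gt0//= ler_pdivrMr// mul1r; lra.
move=> l /andP[l0 l1]; have Kl : 0 < K / l by rewrite divr_gt0//; lra.
(* [s - 2 * H = K / l] is the time given by [conical_dist_le] for the size [l]. *)
exists (2 * H + K / l) => [|a b]; first by lra.
split=> [ab|dl].
  have := @conical_dist_le (K / l) a b Kl; rewrite -/K.
  have -> : K / (K / l) = l by field; rewrite !gt_eqF//; lra.
  by apply; move: ab; congr (agree _ a b); ring.
apply: agree_of_conical_dist; first by lra.
have sE : 0 < 2 * H + K / l + E by lra.
have key : l * (2 * H + K / l + E) <= K + E + 2 * H.
  have -> : l * (2 * H + K / l + E) = 2 * H * l + K + E * l by field; rewrite gt_eqF.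
  have lH : 2 * H * l <= 2 * H by rewrite ler_piMr//; lra.
  have lE : E * l <= E by rewrite ler_piMr.
  lra.
apply: lt_le_trans dl _; rewrite -/k ler_pdivlMr//.
by rewrite -!mulrA ler_piMr ?(ltW k0)// ler_pdivrMl// mulr1.
Qed.

End Conical.

(** * Chain metrics of quasi-metrics *)

Section ChainMetric.
Context {R : realType} {Z : Type}.
Variable rho : Z -> Z -> R.
Hypothesis rho_ge0 : forall a b, 0 <= rho a b.
Hypothesis rho_quasi : forall a b c, rho a c <= 2 * Num.max (rho a b) (rho b c).

(** Counting the inner steps twice is what makes the induction close.  Let [p] be
    the last index with [rho (x i) (x j) <= 2 * rho (x p) (x j)].  The
    quasi-metric inequality at [p.+1] then gives
    [rho (x i) (x j) <= 2 * rho (x i) (x p.+1)], and the average of the two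
    bounds is a sum over two shorter chains that overlap in the step from [p] to
    [p.+1]. *)
Lemma chain_length_ge (x : nat -> Z) (i j : nat) : (i < j)%N ->
  rho (x i) (x j) <= 2 * (\sum_(i <= k < j) rho (x k) (x k.+1) +
                          \sum_(i.+1 <= k < j.-1) rho (x k) (x k.+1)).
Proof.
pose S i j := \sum_(i <= k < j) rho (x k) (x k.+1).
have S0 p q : 0 <= S p q by apply: sumr_ge0 => k _; exact: rho_ge0.
rewrite -/(S i j) -/(S i.+1 j.-1).
have [m] := ubnP (j - i); elim: m i j => // m IH i j jim ij.
pose good p := [&& (i <= p)%N, (p < j)%N & rho (x i) (x j) <= 2 * rho (x p) (x j)].
have gi : exists p, good p.
  exists i; rewrite /good leqnn ij /=; have := rho_ge0 (x i) (x j); lra.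
have gj p : good p -> (p <= j)%N by case/and3P => _ /ltnW.
have [p /and3P[ip pj rp] pmax] := ex_maxnP gi gj.
have Sl q r : (q < r)%N -> S q r = rho (x q) (x q.+1) + S q.+1 r.
  by move=> qr; rewrite /S big_ltn.
have Sr q r : (q <= r)%N -> S q r.+1 = S q r + rho (x r) (x r.+1).
  by move=> qr; rewrite /S big_nat_recr.
have Scat q r s : (q <= r)%N -> (r <= s)%N -> S q s = S q r + S r s.
  by move=> qr rs; rewrite /S (@big_cat_nat _ _ _ r).
have := S0 i.+1 j.-1.
have [pj1|pj1] := eqVneq p.+1 j.
  move=> Sm; apply: le_trans rp _; rewrite ler_pM2l//.
  by move: Sm; rewrite -pj1 (Sr i p ip); have := S0 i p; lra.
have {}pj1 : (p.+1 < j)%N by rewrite ltn_neqAle pj1.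
have np : 2 * rho (x p.+1) (x j) < rho (x i) (x j).
  rewrite ltNge; apply/negP => H.
  have /pmax : good p.+1 by rewrite /good H pj1 (leq_trans ip).
  by rewrite ltnn.
have rq : rho (x i) (x j) <= 2 * rho (x i) (x p.+1).
  by have := rho_quasi (x i) (x p.+1) (x j); case: (leP (rho (x i) (x p.+1))) => _; lra.
have H1 : rho (x i) (x p.+1) <= 2 * (S i p.+1 + S i.+1 p).
  have := IH i p.+1; rewrite /=; apply; lia.
have [ipe|ipn] := eqVneq i p.
  move=> Sm; apply: le_trans rq _; rewrite ler_pM2l// -ipe Sl//.
  by have := S0 i.+1 j; lra.
have {}ip : (i < p)%N by rewrite ltn_neqAle ipn.
have H2 : rho (x p) (x j) <= 2 * (S p j + S p.+1 j.-1).
  by apply: IH => //; lia.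
move=> _.
have e1 := Scat i p j (ltnW ip) (ltnW pj).
have e2 := Scat i.+1 p j.-1 ip ltac:(lia).
have e3 := Sl p j.-1 ltac:(lia).
have e4 := Sr i p (ltnW ip).
lra.
Qed.

Definition chain_dist (a b : Z) : R :=
  inf [set s | exists (n : nat) (c : nat -> Z),
    [/\ c 0%N = a, c n = b & s = \sum_(i < n) rho (c i) (c i.+1)]].

Lemma chain_dist_le a b : chain_dist a b <= rho a b.
Proof.
apply: ge_inf.
  by exists 0 => _ [n [c [_ _ ->]]]; apply: sumr_ge0 => k _; exact: rho_ge0.
exists 1%N, (fun i => if i is 0%N then a else b); split=> //.
by rewrite big_ord1.
Qed.

Lemma chain_dist_ge a b : (forall a, rho a a = 0) -> rho a b <= 4 * chain_dist a b.
Proof.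
move=> rho0; rewrite -ler_pdivrMl//; apply: lb_le_inf.
  by exists (rho a b), 1%N, (fun i => if i is 0%N then a else b); rewrite big_ord1.
move=> _ [[|n] [c [<- <- ->]]]; first by rewrite big_ord0 rho0 mulr0.
rewrite ler_pdivrMl//; apply: le_trans (chain_length_ge c (ltn0Sn n)) _.
have -> : 4 = 2 * 2 :> R by ring.
rewrite -mulrA ler_pM2l// mulrDl mul1r -(big_mkord xpredT (fun i => rho (c i) (c i.+1))) lerD2l.
case: n => [|n]; first by rewrite [leLHS]big_geq//; apply: sumr_ge0 => k _; exact: rho_ge0.
rewrite /= [leRHS]big_ltn// [X in _ <= _ + X]big_nat_recr//=.
by have := rho_ge0 (c 0%N) (c 1%N); have := rho_ge0 (c n.+1) (c n.+2); lra.
Qed.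

End ChainMetric.

(** * The visual metric *)

Section Visual.
Context {R : realType} {X : metricType R}.
Variables (x0 : X) (delta eps : R).
Hypothesis X0 : cat0 X.
Hypothesis Xproper : proper_space X.
Hypothesis Xhyp : hyperbolic (@mdist R X) delta.
Hypothesis eps0 : 0 < eps.
Implicit Types (a b c : boundary X) (x y : nat -> X) (s t : R).

Local Notation ray := (boundary_ray x0).
Local Notation H := (agree_bound delta).
Local Notation agree := (agree x0 delta).
Local Notation gp := (gromov_product mdist x0).

Lemma near_prod_ooP (Q : set (nat * nat)) :
  filter_prod (\oo : set_system nat) (\oo : set_system nat) Q <->
  exists N, forall i j, (N <= i)%N -> (N <= j)%N -> Q (i, j).
Proof.
split=> [[[A B] /= [[N _ NA] [M _ MB]] AB]|[N NQ]].
  exists (maxn N M) => i j; rewrite !geq_max => /andP[Ni _] /andP[_ Mj].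
  by apply: AB; split; [exact: NA|exact: MB].
exists ([set i | (N <= i)%N], [set j | (N <= j)%N]) => /=.
  by split; exists N.
by move=> [i j] /= [Ni Nj]; exact: NQ.
Qed.

Lemma gromov_equivP x y : gromov_equiv x0 x y <->
  forall M, exists N, forall i j, (N <= i)%N -> (N <= j)%N -> M <= gp (x i) (y j).
Proof.
rewrite /gromov_equiv cvgryPge.
split=> xy M; first by have /near_prod_ooP := xy M.
by apply: (near_prod_ooP (fun ij => M <= gp (x ij.1) (y ij.2))).2; exact: xy.
Qed.

Lemma gromov_productC (u v : X) : gp u v = gp v u.
Proof. by rewrite /gromov_product (metric_sym u v); lra. Qed.

Lemma gromov_product_lip (u v w : X) : gp u v - mdist v w <= gp u w.
Proof.
have := metric_triangle u v w; have := metric_triangle v w x0.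
by rewrite /gromov_product; lra.
Qed.

Lemma hyp_ge (u v w : X) s : s <= gp u v -> s <= gp v w -> s - delta <= gp u w.
Proof.
move=> uv vw; have := Xhyp u v w x0; apply: le_trans.
by rewrite lerB// le_min uv.
Qed.

Lemma cvg_boundary_ray x a : cvg_boundary x0 x a ->
  forall M, exists N, forall i n, (N <= i)%N -> (N <= n)%N -> M <= gp (x i) (ray a n%:R).
Proof.
move=> [_ [g ag /gromov_equivP xg]] M.
have [gg [K gK]] := boundary_ray_asymptotic x0 X0 Xproper ag.
have [N NP] := xg (M + K); exists N => i n Ni Nn.
have := gromov_product_lip (x i) (g n%:R) (ray a n%:R).
have := gK n%:R (ler0n _ _); rewrite metric_sym.
by have := NP i n Ni Nn; lra.
Qed.

Lemma boundary_ray_cvg a : cvg_boundary x0 (fun n => ray a n%:R) a.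
Proof.
have [ga a0 aa] := boundary_rayP x0 X0 Xproper a.
suff aeq : gromov_equiv x0 (fun n => ray a n%:R) (fun n => ray a n%:R).
  by split=> //; exists (ray a).
apply/gromov_equivP => M; have [N _ NP] := @nbhs_infty_ger R M.
exists N => i j Ni Nj; rewrite -{1}a0 ray_gromov_product ?ler0n//.
by rewrite le_min !NP.
Qed.

(** A form of [s <= boundary_product x0 a b] in which the supremum is attained and
    no extended real occurs; it lies between the strict and the large
    inequality. *)
Definition boundary_product_ge a b s : Prop := exists x y,
  [/\ cvg_boundary x0 x a, cvg_boundary x0 y b & exists N, forall i j,
    (N <= i)%N -> (N <= j)%N -> s <= gp (x i) (y j)].
Local Notation bpge := boundary_product_ge.

Lemma boundary_product_geW a b s : bpge a b s -> (s%:E <= boundary_product x0 a b)%E.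
Proof.
move=> [x [y [xa yb [N NP]]]].
set f := fun ij : nat * nat => (gp (x ij.1) (y ij.2))%:E.
apply: (@le_trans _ _ (limf_einf f (filter_prod (\oo : set_system nat) (\oo : set_system nat)))).
  rewrite limf_einfE.
  apply: (@le_trans _ _ (ereal_inf (f @` [set ij | (N <= ij.1)%N /\ (N <= ij.2)%N]))).
    apply: le_ereal_inf_tmp => _ [[i j] [/= Ni Nj] <-].
    by rewrite lee_fin NP.
  apply: ereal_sup_ubound; exists [set ij | (N <= ij.1)%N /\ (N <= ij.2)%N] => //.
  by apply/near_prod_ooP; exists N.
by apply: ereal_sup_ubound; exists x, y.
Qed.

Lemma boundary_product_gt a b s : (s%:E < boundary_product x0 a b)%E -> bpge a b s.
Proof.
move=> /ereal_sup_gt[_ [x [y [xa yb ->]]]]; rewrite limf_einfE.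
move=> /ereal_sup_gt[_ [V /near_prod_ooP[N NV] <-]] sV.
exists x, y; split=> //; exists N => i j Ni Nj; rewrite -lee_fin.
apply/ltW/(lt_le_trans sV); apply: ereal_inf_lbound.
by exists (i, j) => //; exact: NV.
Qed.

Lemma boundary_product_ge_of_agree a b s : 0 <= s -> agree s a b -> bpge a b (s - H / 2).
Proof.
move=> s0; rewrite agreeE// => sab.
exists (fun n => ray a n%:R), (fun n => ray b n%:R).
split; [exact: boundary_ray_cvg|exact: boundary_ray_cvg|].
have [N _ NP] := @nbhs_infty_ger R s.
exists N => i j /NP /= si /NP /= sj.
have [ga a0 _] := boundary_rayP x0 X0 Xproper a.
have [gb b0 _] := boundary_rayP x0 X0 Xproper b.
have iE : mdist (ray a i%:R) x0 = i%:R by rewrite metric_sym -{1}a0 ray_dist0.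
have jE : mdist (ray b j%:R) x0 = j%:R by rewrite metric_sym -{1}b0 ray_dist0.
have := metric_triangle (ray a i%:R) (ray a s) (ray b j%:R).
have := metric_triangle (ray a s) (ray b s) (ray b j%:R).
rewrite ga ?ler0n// gb ?ler0n// (distrC s) !ger0_norm ?subr_ge0//.
by move: sab; rewrite /gromov_product iE jE /ray_dist; lra.
Qed.

(** The sequences that realise the product are replaced, one at a time, by the
    integer points of the rays, with a loss of [delta] each time. *)
Lemma agree_of_boundary_product_ge a b s : bpge a b s -> agree (s - 2 * delta) a b.
Proof.
move=> [x [y [xa yb [N NP]]]].
have [N1 N1P] := cvg_boundary_ray xa s.
have [N2 N2P] := cvg_boundary_ray yb s.
pose n := maxn N (maxn N1 N2).
have Nn : (N <= n)%N by rewrite leq_maxl.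
have N1n : (N1 <= n)%N by rewrite !leq_max leqnn orbT.
have N2n : (N2 <= n)%N by rewrite !leq_max leqnn !orbT.
have d0 := hyperbolic_delta_ge0 x0 Xhyp.
have H1 : s - delta <= gp (x n) (ray b n%:R).
  by apply: hyp_ge (NP n n Nn Nn) _; exact: N2P.
have H2 : s - 2 * delta <= gp (ray a n%:R) (ray b n%:R).
  rewrite (_ : _ - _ = s - delta - delta); last by ring.
  apply: hyp_ge H1; rewrite gromov_productC.
  by have := N1P n n N1n N1n; lra.
have [ga a0 _] := boundary_rayP x0 X0 Xproper a.
have [gb b0 _] := boundary_rayP x0 X0 Xproper b.
have aE : mdist (ray a n%:R) x0 = n%:R by rewrite metric_sym -{1}a0 ray_dist0.
have bE : mdist (ray b n%:R) x0 = n%:R by rewrite metric_sym -{1}b0 ray_dist0.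
rewrite /gromov_product aE bE in H2.
have -> : s - 2 * delta = n%:R - (2 * n%:R - 2 * s + 4 * delta) / 2 by field.
apply: (agree_of_ray_dist X0 Xproper Xhyp) => //.
by rewrite /ray_dist; lra.
Qed.

(** Two sequences may be needed for [b], one for each product; passing from one to
    the other costs a second [delta], since their mutual product tends to
    infinity. *)
Lemma boundary_product_ge_quasi a b c s :
  bpge a b s -> bpge b c s -> bpge a c (s - 2 * delta).
Proof.
move=> [x [y [xa yb [N NP]]]] [y' [z [yb' zc [M MP]]]].
exists x, z; split=> //; exists (maxn N M) => i j.
rewrite !geq_max => /andP[Ni _] /andP[_ Mj].
have [N1 N1P] := cvg_boundary_ray yb (s + delta).
have [N2 N2P] := cvg_boundary_ray yb' (s + delta).
pose n := maxn (maxn N M) (maxn N1 N2).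
have Nn : (N <= n)%N by rewrite !leq_max leqnn.
have Mn : (M <= n)%N by rewrite !leq_max leqnn orbT.
have N1n : (N1 <= n)%N by rewrite !leq_max leqnn !orbT.
have N2n : (N2 <= n)%N by rewrite !leq_max leqnn !orbT.
have yy' : s <= gp (y n) (y' n).
  rewrite -(addrK delta s); apply: hyp_ge (N1P n n N1n N1n) _.
  by rewrite gromov_productC; exact: N2P.
have yz : s - delta <= gp (y n) (z j) := hyp_ge yy' (MP n j Mn Mj).
rewrite (_ : _ - _ = s - delta - delta); last by ring.
apply: hyp_ge yz; have := NP i n Ni Nn; have := hyperbolic_delta_ge0 x0 Xhyp; lra.
Qed.

Local Notation rho := (visual_rho x0 eps).

Lemma visual_rho_ge0 a b : 0 <= rho a b.
Proof. by rewrite /visual_rho fine_ge0// expeR_ge0. Qed.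

Lemma visual_rho_le a b s : bpge a b s -> rho a b <= expR (- (eps * s)).
Proof.
move=> /boundary_product_geW; rewrite /visual_rho.
case: (boundary_product x0 a b) => [r||] //=.
- by rewrite lee_fin => sr; rewrite ler_expR lerN2 ler_pM2l.
- by move=> _; rewrite gt0_muley ?lte_fin//= expR_ge0.
Qed.

Lemma visual_rho_lt a b s : rho a b < expR (- (eps * s)) -> bpge a b s.
Proof.
have ab0 : ((0 - H / 2)%:E <= boundary_product x0 a b)%E.
  apply/boundary_product_geW/boundary_product_ge_of_agree => //.
  exact: (agree_le0 x0 X0 Xproper Xhyp).
move=> rs; apply: boundary_product_gt; move: ab0 rs; rewrite /visual_rho.
case: (boundary_product x0 a b) => [r||] //=.
- by move=> _; rewrite ltr_expR ltrN2 ltr_pM2l// lte_fin.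
- by move=> _ _; rewrite ltry.
Qed.

Lemma visual_rho_self a : rho a a = 0.
Proof.
apply/eqP; rewrite eq_le visual_rho_ge0 andbT leNgt; apply/negP => r0.
pose s := (1 - ln (rho a a)) / eps.
have : rho a a <= expR (- (eps * (s + 0))).
  apply: visual_rho_le; exists (fun n => ray a n%:R), (fun n => ray a n%:R).
  have [_ [g ag _]] := boundary_ray_cvg a.
  split; [exact: boundary_ray_cvg|exact: boundary_ray_cvg|].
  by have /gromov_equivP := (boundary_ray_cvg a).1; exact.
rewrite addr0 mulrC divfK ?gt_eqF// opprB expRD lnK ?posrE// => H1.
have : rho a a * expR (-1) < rho a a by rewrite gtr_pMr// expR_lt1 ltrN10.
by rewrite ltNge H1.
Qed.

Hypothesis eps_delta : expR (eps * delta) - 1 <= Num.sqrt 2 - 1.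

(** This is where the condition on [eps] enters: it gives
    [expR (eps * (2 * delta)) <= 2]. *)
Lemma visual_rho_quasi a b c : rho a c <= 2 * Num.max (rho a b) (rho b c).
Proof.
have exp2 : expR (2 * (eps * delta)) <= 2.
  have e2 : expR (eps * delta) <= Num.sqrt 2 by have := eps_delta; lra.
  rewrite mulr_natl mulr2n expRD -[leRHS](sqr_sqrtr (ler0n R 2)) expr2.
  by apply: ler_pM; rewrite ?expR_ge0.
set m := Num.max _ _; rewrite leNgt; apply/negP => mr.
have m0 : 0 <= m by rewrite le_max visual_rho_ge0.
pose u := (m + rho a c / 2) / 2.
have mu : m < u by rewrite /u; lra.
have ur : 2 * u < rho a c by rewrite /u; lra.
have u0 : 0 < u by lra.
pose s := - ln u / eps.
have su : expR (- (eps * s)) = u.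
  by rewrite /s mulrC divfK ?gt_eqF// opprK lnK.
have ab : bpge a b s by apply: visual_rho_lt; rewrite su; apply: le_lt_trans mu; rewrite le_max lexx.
have bc : bpge b c s by apply: visual_rho_lt; rewrite su; apply: le_lt_trans mu; rewrite le_max lexx orbT.
have := visual_rho_le (boundary_product_ge_quasi ab bc).
rewrite (_ : - (eps * (s - 2 * delta)) = - (eps * s) + 2 * (eps * delta)); last by ring.
rewrite expRD su leNgt => /negP; apply; apply: le_lt_trans ur.
by rewrite mulrC ler_pM2r.
Qed.

Lemma visual_dist_le a b s : 0 <= s -> agree s a b ->
  visual_dist x0 eps a b <= expR (eps * (H / 2)) * expR (- (eps * s)).
Proof.
move=> s0 sab; apply: le_trans (chain_dist_le visual_rho_ge0 a b) _.
apply: le_trans (visual_rho_le (boundary_product_ge_of_agree s0 sab)) _.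
by rewrite -expRD ler_expR; lra.
Qed.

Lemma agree_of_visual_dist a b s :
  visual_dist x0 eps a b < expR (- (eps * (s + 2 * delta))) / 4 -> agree s a b.
Proof.
move=> dv; rewrite -(addrK (2 * delta) s).
apply: agree_of_boundary_product_ge; apply: visual_rho_lt.
have := chain_dist_ge visual_rho_ge0 visual_rho_quasi a b visual_rho_self.
by rewrite -/(visual_dist x0 eps a b); lra.
Qed.

Lemma visual_dist_gauged : gauged agree H (visual_dist x0 eps).
Proof.
move=> E E0; have H1 := agree_bound_ge1 x0 Xhyp; have d0 := hyperbolic_delta_ge0 x0 Xhyp.
set K := expR (eps * (H / 2)); have K1 : 1 <= K.
  by rewrite -expR0 ler_expR mulr_ge0 ?ltW//; lra.
have K0 : 0 < K by lra.
set q := expR (- (eps * (E + 2 * delta + 2 * H))).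
have q0 : 0 < q := expR_gt0 _.
have q1 : q <= 1 by rewrite -expR0 ler_expR oppr_le0 mulr_ge0 ?(ltW eps0)//; lra.
exists (q / (4 * K)), K; split=> //.
  by rewrite divr_gt0 ?mulr_gt0//= ler_pdivrMr ?mulr_gt0// mul1r; lra.
move=> l /andP[l0 lK]; pose s := - ln (l / K) / eps.
have lK0 : 0 < l / K by rewrite divr_gt0.
have s0 : 0 <= s.
  by rewrite divr_ge0 ?(ltW eps0)// oppr_ge0 ln_le0// ler_pdivrMr// mul1r.
have sl : expR (- (eps * s)) = l / K.
  by rewrite /s mulrC divfK ?gt_eqF// opprK lnK.
exists (s + 2 * H) => [|a b]; first by lra.
rewrite addrK; split=> [sab|dl].
  by apply: le_trans (visual_dist_le s0 sab) _; rewrite sl mulrC divfK ?gt_eqF.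
apply: agree_of_visual_dist; apply: lt_le_trans dl _.
have -> : - (eps * (s + 2 * H + E + 2 * delta)) =
  - (eps * s) - eps * (E + 2 * delta + 2 * H) by ring.
rewrite expRD sl -/q le_eqVlt; apply/orP; left; apply/eqP.
by field; rewrite gt_eqF.
Qed.

End Visual.

(** * Quasi-geodesics in hyperbolic spaces *)

Section QuasiGeodesics.
Context {R : realType} {Y : Type}.
Variables (d : Y -> Y -> R) (delta : R).
Hypothesis d_ge0 : forall x y, 0 <= d x y.
Hypothesis d_refl : forall x, d x x = 0.
Hypothesis d_sym : forall x y, d x y = d y x.
Hypothesis d_tri : forall x y z, d x z <= d x y + d y z.
Hypothesis d_hyp : hyperbolic d delta.
Implicit Types (x y z w : Y) (L s : R).

Local Notation gp := (gromov_product d).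

(** In the word metric of a group these are the vertices met by a geodesic of the
    Cayley graph. *)
Definition discrete_geodesic (v : nat -> Y) (n : nat) : Prop :=
  forall i j, (i <= j <= n)%N -> d (v i) (v j) = (j - i)%:R.

Definition quasi_geodesic L (q : nat -> Y) (n : nat) : Prop :=
  forall i j, (i <= j <= n)%N ->
    d (q i) (q j) <= L * (j - i)%:R /\ (j - i)%:R <= L * d (q i) (q j) + L.

Let hyp_delta_ge0 x : 0 <= delta.
Proof. by have := d_hyp x x x x; rewrite /gromov_product d_refl minxx; lra. Qed.

Let hyp_le w x y z s : s <= gp w x y -> s <= gp w y z -> s - delta <= gp w x z.
Proof.
move=> xy yz; have := d_hyp x y z w; apply: le_trans.
by rewrite lerB// le_min xy.
Qed.

Lemma gromov_product_base_lip w w' x y : gp w x y <= gp w' x y + d w w'.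
Proof.
have := d_tri x w' w; have := d_tri y w' w.
by rewrite (d_sym w' w) /gromov_product; lra.
Qed.

(** Halving the path [k] times applies the hyperbolic inequality [k] times only:
    a path that avoids a large ball around a geodesic point must be exponentially
    long. *)
Lemma gromov_product_path w s (k m : nat) (y : nat -> Y) :
  (0 < m <= 2 ^ k)%N -> (forall i, (i < m)%N -> s <= gp w (y i) (y i.+1)) ->
  s - k%:R * delta <= gp w (y 0%N) (y m).
Proof.
have d0 := hyp_delta_ge0 w.
elim: k m y => [|k IH] m y /andP[m0 mk] ys.
  rewrite expn0 in mk; have -> : m = 1%N by lia.
  by rewrite mul0r subr0; apply: ys.
have [m1|m1] := eqVneq m 1%N.
  rewrite m1; apply: le_trans (ys 0%N m0); rewrite gerBl mulr_ge0//.
rewrite expnS in mk.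
have H1 : s - k%:R * delta <= gp w (y 0%N) (y m./2).
  by apply: IH => [|i im]; [lia|apply: ys; lia].
have H2 : s - k%:R * delta <= gp w (y m./2) (y m).
  have := IH (m - m./2)%N (fun i => y (m./2 + i)%N); rewrite addn0 subnKC; last by lia.
  by apply=> [|i im]; [lia|rewrite addnS; apply: ys; lia].
rewrite -natr1 mulrDl mul1r opprD addrA; exact: hyp_le H1 H2.
Qed.

Lemma discrete_geodesic_product v n i l j : discrete_geodesic v n ->
  (i <= l)%N -> (l <= j)%N -> (j <= n)%N -> gp (v l) (v i) (v j) = 0.
Proof.
move=> vg il lj jn; rewrite /gromov_product (d_sym (v j)) !vg.
- by rewrite -natrD (_ : l - i + (j - l) = j - i)%N ?subrr ?mul0r//; lia.
- by rewrite (leq_trans il).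
- by rewrite lj.
- by rewrite il (leq_trans lj).
Qed.

Lemma quasi_geodesic_step L q n p : quasi_geodesic L q n -> (p < n)%N ->
  d (q p) (q p.+1) <= L.
Proof.
by move=> qg pn; have [|+ _] := qg p p.+1; rewrite ?leqnSn// subSnn mulr1.
Qed.

Lemma quasi_geodesic_lip L q n i j : quasi_geodesic L q n -> (i <= n)%N -> (j <= n)%N ->
  d (q i) (q j) <= L * `|i%:R - j%:R| /\ `|i%:R - j%:R| <= L * d (q i) (q j) + L.
Proof.
move=> qg iN jN; have [ij|/ltnW ji] := leqP i j.
  by rewrite distrC -natrB// normr_nat; apply: qg; rewrite ij.
by rewrite -natrB// normr_nat d_sym; apply: qg; rewrite ji.
Qed.

(** The hypothesis says that [D] is bounded by an affine function of its own
    logarithm.  Comparing with a square root is enough: the exponent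
    [k = 2 * j], with [j] just above the root of [c2 * D + c3], is admissible as
    [j ^ 2 <= 2 ^ (2 * j)], and a quadratic inequality for the root results. *)
Lemma bounded_of_le_log (c1 c2 c3 b : R) : 0 <= c1 -> 0 < c2 -> 0 <= c3 -> 0 <= b ->
  exists D0 : R, forall D, 0 <= D ->
    (forall k : nat, c2 * D + c3 <= (2 ^ k)%:R -> D <= c1 + k%:R * b) -> D <= D0.
Proof.
move=> c10 c20 c30 b0; pose B := 2 * b * c2; pose G := c3 + c2 * (c1 + 2 * b).
have B0 : 0 <= B by rewrite !mulr_ge0// ltW.
have G0 : 0 <= G by rewrite addr_ge0// mulr_ge0 ?(ltW c20)//; lra.
exists (c1 + 2 * b * (B + G + 2)) => D D0 kP.
pose x := Num.sqrt (c2 * D + c3).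
have cD0 : 0 <= c2 * D + c3 by rewrite addr_ge0// mulr_ge0// ltW.
have x0 : 0 <= x := sqrtr_ge0 _.
have xE : x ^+ 2 = c2 * D + c3 by rewrite sqr_sqrtr.
pose j := (Num.truncn x).+1.
have xj : x < j%:R by rewrite truncnS_gt.
have jx : j%:R <= x + 1 by rewrite -natr1 lerD2r truncn_le.
have Dj : D <= c1 + (2 * j)%:R * b.
  apply: kP; rewrite -xE; apply: (@le_trans _ _ (j%:R ^+ 2)).
    by rewrite !expr2; apply: ler_pM => //; exact: ltW.
  by rewrite -natrX ler_nat mulnC expnM leq_exp2r// ltnW// ltn_expl.
have xBG : x <= B + G + 1.
  rewrite leNgt; apply/negP => Hx.
  have : x ^+ 2 <= G + B * x.
    have : c2 * D <= c2 * (c1 + 2 * (x + 1) * b).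
      rewrite ler_pM2l//; apply: le_trans Dj _; rewrite lerD2l natrM.
      by rewrite ler_wpM2r// ler_wpM2l.
    by rewrite xE /G /B; lra.
  have : (B + G + 1) * x < x ^+ 2 by rewrite expr2 ltr_pM2r//; lra.
  have : G * 1 <= G * x by rewrite ler_wpM2l//; lra.
  lra.
apply: le_trans Dj _; rewrite lerD2l natrM mulrAC ler_wpM2l//; lra.
Qed.

Lemma quasi_geodesic_avoiding L q n w D (k : nat) i j : 0 <= delta -> 0 <= L ->
  quasi_geodesic L q n -> (forall i, (i <= n)%N -> D <= d w (q i)) ->
  (i <= n)%N -> (j <= n)%N -> `|i%:R - j%:R| <= (2 ^ k)%:R :> R ->
  D - L - k%:R * delta <= gp w (q i) (q j).
Proof.
move=> d0 L0 qg qD; have kd : 0 <= k%:R * delta by rewrite mulr_ge0.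
wlog ij : i j / (i <= j)%N.
  move=> W iN jN ijk; have [ij|/ltnW ji] := leqP i j; first exact: W.
  rewrite /gromov_product (d_sym (q i) (q j)) (addrC (d (q i) w)).
  by apply: W => //; rewrite distrC.
move=> iN jN; rewrite distrC -natrB// normr_nat ler_nat => ijk.
move: ij; rewrite leq_eqVlt => /orP[/eqP <-|ij].
  by rewrite /gromov_product d_refl (d_sym (q i)); have := qD i iN; lra.
have := @gromov_product_path w (D - L) k (j - i) (fun p => q (i + p)%N).
rewrite addn0 subnKC ?(ltnW ij)//; apply; first by rewrite subn_gt0 ij.
move=> p pij; have pn : (i + p < n)%N by lia.
rewrite addnS; have := quasi_geodesic_step qg pn.
have := qD _ (ltnW pn); have := qD _ pn.
by rewrite /gromov_product (d_sym (q (i + p)%N) w) (d_sym (q (i + p).+1) w); lra.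
Qed.

Lemma finite_argmin n (F : 'I_n.+1 -> R) : exists i, forall j, F i <= F j.
Proof. by case: (@arg_minP _ R _ ord0 xpredT F isT) => i _ iP; exists i => j; exact: iP. Qed.

(** Take the point [w] of the geodesic farthest from the quasi-geodesic, at
    distance [D], and go from [w] along the geodesic by slightly more than
    [2 * D] on both sides, or up to an end point.  The two points reached are
    within [D] of the quasi-geodesic, so they can be joined by a path whose length
    is linear in [D] and which stays at distance about [D] from [w]; hence [D] is
    at most logarithmic in [D] by [gromov_product_path]. *)
Lemma geodesic_near_quasi_geodesic L : 1 <= L -> 0 <= delta -> exists D0 : R,
  forall (q v : nat -> Y) n N, quasi_geodesic L q n -> discrete_geodesic v N ->
    v 0%N = q 0%N -> v N = q n ->
    forall l, (l <= N)%N -> exists2 i, (i <= n)%N & d (v l) (q i) <= D0.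
Proof.
move=> L1 d0; have [D0 D0P] := @bounded_of_le_log (L + 2 * delta) (6 * L) (3 * L) delta
  ltac:(lra) ltac:(lra) ltac:(lra) d0.
exists D0 => q v n N qg vg v0 vN.
have near l : exists i : 'I_n.+1, forall j : 'I_n.+1, d (v l) (q i) <= d (v l) (q j).
  exact: finite_argmin.
have [nr nrP] := choice near.
have [l0 lmax] := finite_argmin (fun l : 'I_N.+1 => - d (v l) (q (nr l))).
set D := d (v l0) (q (nr l0)) in lmax.
have {}lmax l : (l <= N)%N -> d (v l) (q (nr l)) <= D.
  by move=> lN; have := lmax (Ordinal (lN : (l < N.+1)%N)); rewrite lerN2.
suff DD0 : D <= D0.
  move=> l lN; exists (nr l) => //; first by rewrite -ltnS ltn_ord.
  by apply: le_trans DD0; exact: lmax.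
have Dge0 : 0 <= D by exact: d_ge0.
have vnear l : (l <= N)%N -> exists2 i, (i <= n)%N & d (v l) (q i) <= D.
  move=> lN; exists (nr l); first by rewrite -ltnS ltn_ord.
  exact: lmax.
set w := v l0 in D lmax vnear Dge0 *.
have wfar i : (i <= n)%N -> D <= d w (q i).
  by move=> iN; exact: (nrP l0 (Ordinal (iN : (i < n.+1)%N))).
have l0N : (l0 <= N)%N by rewrite -ltnS ltn_ord.
pose K := (Num.truncn (2 * D)).+1.
have KD : 2 * D < K%:R by rewrite truncnS_gt.
have KD1 : K%:R <= 2 * D + 1 by rewrite /K -natr1 lerD2r truncn_le// mulr_ge0.
have [i iN [ai aw aiw]] : exists2 i, (i <= n)%N & [/\ d (v (l0 - K)%N) (q i) <= D,
    d (v (l0 - K)%N) w <= 2 * D + 1 & D <= gp w (v (l0 - K)%N) (q i)].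
  have vw : d (v (l0 - K)%N) w = (l0 - (l0 - K))%:R by apply: vg; rewrite leq_subr.
  have [Kl|lK] := leqP K l0.
    rewrite subKn// in vw; have [i iN ai] := vnear (l0 - K)%N ltac:(lia).
    exists i => //; rewrite vw; split=> //.
    rewrite /gromov_product vw (d_sym (q i)); have := wfar i iN; lra.
  have e : (l0 - K = 0)%N by lia.
  exists 0%N => //; rewrite vw e v0 d_refl subn0; split=> //.
    by apply: le_trans KD1; rewrite ler_nat ltnW.
  by rewrite /gromov_product d_refl (d_sym (q 0%N)); have := wfar 0%N isT; lra.
(* The truncated subtraction [l0 - K] and the minimum stop at the end points. *)
pose b := minn (l0 + K) N.
have [j jN [bj bw bjw]] : exists2 j, (j <= n)%N & [/\ d (v b) (q j) <= D,
    d (v b) w <= 2 * D + 1 & D <= gp w (q j) (v b)].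
  have vw : d (v b) w = (b - l0)%:R by rewrite d_sym; apply: vg; rewrite /b; lia.
  have [Kl|lK] := leqP (l0 + K) N.
    have e : b = (l0 + K)%N by rewrite /b; lia.
    have [j jN bj] := vnear b ltac:(lia).
    rewrite e addKn in vw; rewrite e in bj *.
    exists j => //; rewrite vw; split=> //.
    rewrite /gromov_product vw (d_sym (q j) w) (d_sym (q j)); have := wfar j jN; lra.
  have e : b = N by rewrite /b; lia.
  exists n => //; rewrite vw e vN d_refl; split=> //.
    by apply: le_trans KD1; rewrite ler_nat; lia.
  by rewrite /gromov_product d_refl (d_sym (q n)); have := wfar n (leqnn _); lra.
apply: D0P => // k Dk.
have ij : `|i%:R - j%:R| <= 6 * L * D + 3 * L.
  have [_] := quasi_geodesic_lip qg iN jN; move=> /le_trans; apply.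
  have : d (q i) (q j) <= 6 * D + 2.
    have := d_tri (q i) (v (l0 - K)%N) (q j).
    have := d_tri (v (l0 - K)%N) w (q j).
    have := d_tri w (v b) (q j).
    by rewrite (d_sym (q i) (v (l0 - K)%N)) (d_sym w (v b)); lra.
  move=> dij; have : L * d (q i) (q j) <= L * (6 * D + 2) by rewrite ler_pM2l//; lra.
  by lra.
have qij : D - L - k%:R * delta <= gp w (q i) (q j).
  by apply: quasi_geodesic_avoiding qg wfar iN jN (le_trans ij Dk) => //; lra.
have kd : 0 <= k%:R * delta by rewrite mulr_ge0.
have ab0 : gp w (v (l0 - K)%N) (v b) = 0.
  apply: discrete_geodesic_product vg _ _ _; rewrite ?leq_subr ?geq_minr//.
  by rewrite leq_min leq_addr.
have H1 : D - L - k%:R * delta <= gp w (v (l0 - K)%N) (q i) by lra.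
have H2 : D - L - k%:R * delta - delta <= gp w (v (l0 - K)%N) (q j) := hyp_le H1 qij.
have H3 : D - L - k%:R * delta - delta <= gp w (q j) (v b) by lra.
by have := hyp_le H2 H3; rewrite ab0; lra.
Qed.

(** Consider the last point [v l] of a geodesic that is close to the part of the
    quasi-geodesic before [i].  The next one is close to the part after [i], so
    both parts come close to [v l] near indices [j <= i <= j'], and [j' - j] is
    bounded. *)
Lemma quasi_geodesic_near_line L : 1 <= L -> 0 <= delta ->
  (forall x y, exists v N, [/\ discrete_geodesic v N, v 0%N = x & v N = y]) ->
  exists2 C : R, 0 <= C & forall (q : nat -> Y) n, quasi_geodesic L q n ->
    forall i, (i <= n)%N -> gp (q i) (q 0%N) (q n) <= C.
Proof.
move=> L1 d0 geo; have [D0' D0P] := geodesic_near_quasi_geodesic L1 d0.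
pose D0 := Num.max D0' 0.
have D00 : 0 <= D0 by rewrite le_max lexx orbT.
have D0D : D0' <= D0 by rewrite le_max lexx.
exists (L * (L * (2 * D0 + 1) + L) + D0); first by rewrite addr_ge0// !mulr_ge0 ?addr_ge0 ?mulr_ge0//; lra.
move=> q n qg i iN; have [v [N [vg v0 vN]]] := geo (q 0%N) (q n).
have vq := D0P q v n N qg vg v0 vN.
pose good l := (l <= N)%N && `[< exists2 j, (j <= i)%N & d (v l) (q j) <= D0 >].
have g0 : exists l, good l.
  by exists 0%N; apply/andP; split=> //; apply/asboolP; exists 0%N => //; rewrite v0 d_refl.
have gN l : good l -> (l <= N)%N by case/andP.
have [l /andP[lN /asboolP[j ji lj]] lmax] := ex_maxnP g0 gN.
have [j' /andP[ij' j'n] lj'] : exists2 j', (i <= j' <= n)%N & d (v l) (q j') <= D0 + 1.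
  have [lNe|lNn] := eqVneq l N.
    by exists n; rewrite ?iN ?leqnn// lNe vN d_refl; lra.
  have lN' : (l < N)%N by rewrite ltn_neqAle lNn.
  have [j' j'n lj'] := vq _ lN'.
  have ll1 : d (v l) (v l.+1) = 1 by rewrite vg ?leqnSn// subSnn.
  have ij' : (i < j')%N.
    rewrite ltnNge; apply/negP => j'i.
    suff /lmax : good l.+1 by rewrite ltnn.
    by apply/andP; split=> //; apply/asboolP; exists j' => //; exact: le_trans D0D.
  exists j'; first by rewrite (ltnW ij').
  by have := d_tri (v l) (v l.+1) (q j'); rewrite ll1; lra.
have jj' : d (q j) (q j') <= 2 * D0 + 1.
  by have := d_tri (q j) (v l) (q j'); rewrite (d_sym (q j) (v l)); lra.
have [|_ jj2] := qg j j'; first by rewrite (leq_trans ji).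
have ji2 : d (q j) (q i) <= L * (L * (2 * D0 + 1) + L).
  have [|+ _] := qg j i; [by rewrite ji|move=> /le_trans; apply].
  rewrite ler_pM2l; last by lra.
  apply: (@le_trans _ _ (j' - j)%:R); first by rewrite ler_nat leq_sub2r.
  apply: le_trans jj2 _; rewrite lerD2r ler_pM2l//; lra.
have il : d (q i) (v l) <= L * (L * (2 * D0 + 1) + L) + D0.
  by have := d_tri (q i) (q j) (v l); rewrite (d_sym (q i) (q j)) (d_sym (q j) (v l)); lra.
apply: le_trans (gromov_product_base_lip _ (v l) _ _) _.
suff -> : gp (v l) (q 0%N) (q n) = 0 by rewrite add0r.
by rewrite -v0 -vN; exact: discrete_geodesic_product vg _ lN _.
Qed.

(** At the last index where [q i] is closer, in the sense of the Gromov product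
    based at [w], to the start than to the end, both products are at most that of
    the end points, up to a constant; their sum determines [d w (q i)]. *)
Lemma quasi_geodesic_meets L C (q : nat -> Y) n w : 1 <= L ->
  quasi_geodesic L q n -> (forall i, (i <= n)%N -> gp (q i) (q 0%N) (q n) <= C) ->
  exists2 i, (i <= n)%N & d w (q i) <= gp w (q 0%N) (q n) + (2 * delta + L + C).
Proof.
move=> L1 qg qC; set G := gp w (q 0%N) (q n).
have d0 := hyp_delta_ge0 w.
have C0 : 0 <= C.
  apply: le_trans (qC 0%N isT); rewrite /gromov_product d_refl (d_sym (q n)).
  by rewrite add0r subrr mul0r.
pose good i := (i <= n)%N && (gp w (q i) (q n) <= gp w (q 0%N) (q i)).
have g0 : exists i, good i.
  exists 0%N; rewrite /good /=; have := d_tri w (q 0%N) (q n).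
  by rewrite /gromov_product d_refl (d_sym (q n) w) (d_sym (q 0%N) w); lra.
have gn i : good i -> (i <= n)%N by case/andP.
have [i /andP[iN gi] imax] := ex_maxnP g0 gn.
exists i => //; have [ine|inn] := eqVneq i n.
  move: gi; rewrite ine -/G {1}/gromov_product d_refl (d_sym (q n)); lra.
have iN' : (i < n)%N by rewrite ltn_neqAle inn.
have gi1 : gp w (q 0%N) (q i.+1) < gp w (q i.+1) (q n).
  rewrite ltNge; apply/negP => H; suff /imax : good i.+1 by rewrite ltnn.
  by rewrite /good iN'.
have Hi := d_hyp (q 0%N) (q i) (q n) w; rewrite min_r// -/G in Hi.
have Hi1 := d_hyp (q 0%N) (q i.+1) (q n) w; rewrite min_l ?(ltW gi1)// -/G in Hi1.
have lip := quasi_geodesic_step qg iN'.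
have qCi := qC i iN.
have := d_tri (q i.+1) (q i) w; have := d_tri (q 0%N) (q i) (q i.+1); have := d_tri (q 0%N) (q i.+1) (q i).
have := d_tri (q i) (q i.+1) w.
move: Hi Hi1 qCi; rewrite /G /gromov_product (d_sym w (q i)) (d_sym (q n) (q i)) (d_sym (q i.+1) (q i)) => *.
lra.
Qed.

End QuasiGeodesics.

(** * Thin triangles and quasi-isometry invariance *)

Section ThinTriangles.
Context {R : realType} {X : metricType R}.
Implicit Types (x y z w p : X) (c : R -> X) (s t K : R).

Definition near_segment K c x y p : Prop :=
  exists2 s, 0 <= s <= mdist x y & mdist p (c s) <= K.

Definition thin_triangles K : Prop := forall x y z c1 c2 c3,
  geodesic_segment c1 x y -> geodesic_segment c2 y z -> geodesic_segment c3 x z ->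
  forall t, 0 <= t <= mdist x z ->
    near_segment K c1 x y (c3 t) \/ near_segment K c2 y z (c3 t).

(** The points of a segment at integer times, the last of them being replaced by
    the end point; consecutive points are at distance at most [1]. *)
Definition segment_steps c x y (i : nat) : X := c (Num.min i%:R (mdist x y)).
Definition segment_length x y : nat := (Num.truncn (mdist x y)).+1.

Lemma segment_split c x y s : geodesic_segment c x y -> 0 <= s <= mdist x y ->
  mdist x (c s) + mdist (c s) y = mdist x y.
Proof.
move=> sc s01; rewrite (segment_dist_start sc s01); case: sc => _ cy cd.
have ll : 0 <= mdist x y <= mdist x y by rewrite lexx mdist_ge0.
have := cd s (mdist x y) s01 ll; rewrite cy => ->.
by case/andP: s01 => _ ?; rewrite distrC ger0_norm ?subr_ge0// addrC subrK.
Qed.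

Lemma segment_steps0 c x y : geodesic_segment c x y -> segment_steps c x y 0 = x.
Proof. by case=> c0 _ _; rewrite /segment_steps min_l ?mdist_ge0. Qed.

Lemma segment_steps_end c x y : geodesic_segment c x y ->
  segment_steps c x y (segment_length x y) = y.
Proof.
by case=> _ cy _; rewrite /segment_steps min_r// ltW// truncnS_gt.
Qed.

Lemma segment_step_range x y (i : nat) : 0 <= Num.min i%:R (mdist x y) <= mdist x y.
Proof. by rewrite le_min ler0n mdist_ge0 ge_min lexx orbT. Qed.

Lemma segment_steps_dist c x y (i j : nat) : geodesic_segment c x y ->
  (i <= j <= segment_length x y)%N ->
  mdist (segment_steps c x y i) (segment_steps c x y j) <= (j - i)%:R /\
  (j - i)%:R <= mdist (segment_steps c x y i) (segment_steps c x y j) + 1.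
Proof.
move=> [_ _ cd] /andP[ij jl]; rewrite /segment_steps cd ?segment_step_range//.
set l := mdist x y.
have l0 : 0 <= l := mdist_ge0 _ _.
have jl1 : j%:R <= l + 1.
  apply: (@le_trans _ _ (segment_length x y)%:R); first by rewrite ler_nat.
  by rewrite /segment_length -natr1 lerD2r truncn_le.
have ijR : i%:R <= j%:R :> R by rewrite ler_nat.
rewrite natrB// distrC ger0_norm; last first.
  by rewrite subr_ge0 le_min !ge_min lexx orbT ijR.
by case: (leP i%:R l) => il; case: (leP j%:R l) => jl2; split; lra.
Qed.

Hypothesis geo : geodesic_space X.

Lemma gromov_product_le_segment c x y w s : geodesic_segment c x y ->
  0 <= s <= mdist x y -> gromov_product mdist w x y <= mdist w (c s).
Proof.
move=> sc s01; have := segment_split sc s01.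
have := metric_triangle x (c s) w; have := metric_triangle w (c s) y.
by rewrite /gromov_product (metric_sym (c s) w) (metric_sym w y); lra.
Qed.

(** Walk along the segment: it starts close to the side from [x] to [w] and ends
    close to the side from [w] to [z], and where it changes sides it is close to
    both. *)
Lemma thin_gromov_product_ge K c x z w : 0 <= K -> thin_triangles K ->
  geodesic_segment c x z -> exists2 t, 0 <= t <= mdist x z &
    mdist w (c t) <= gromov_product mdist w x z + (2 * K + 1).
Proof.
move=> K0 thin sc; have [c1 s1] := geo x w; have [c2 s2] := geo w z.
pose n := segment_length x z.
have steps i := thin _ _ _ _ _ _ s1 s2 sc _ (segment_step_range x z i).
pose good i := (i <= n)%N && `[< near_segment K c1 x w (segment_steps c x z i) >].
have g0 : exists i, good i.
  exists 0%N; apply/andP; split=> //; apply/asboolP; rewrite segment_steps0//.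
  exists 0; first by rewrite lexx mdist_ge0.
  by case: s1 => -> _ _; rewrite mdistxx.
have gn i : good i -> (i <= n)%N by case/andP.
have [i /andP[iN /asboolP[u1 u1r iu1]] imax] := ex_maxnP g0 gn.
have [u2 u2r iu2] : near_segment (K + 1) c2 w z (segment_steps c x z i).
  have [->|inn] := eqVneq i n.
    rewrite segment_steps_end//; exists (mdist w z); first by rewrite lexx mdist_ge0.
    by case: s2 => _ -> _; rewrite mdistxx; lra.
  have iN' : (i < n)%N by rewrite ltn_neqAle inn.
  have [[t t01 tK]|[u u01 uK]] : near_segment K c1 x w (segment_steps c x z i.+1) \/
    near_segment K c2 w z (segment_steps c x z i.+1) by exact: steps.
  - suff /imax : good i.+1 by rewrite ltnn.
    by rewrite /good iN' /=; apply/asboolP; exists t.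
  - exists u => //.
    have [+ _] := segment_steps_dist (i := i) (j := i.+1) sc ltac:(by rewrite leqnSn).
    rewrite subSnn; have := metric_triangle (segment_steps c x z i) (segment_steps c x z i.+1) (c2 u).
    lra.
exists (Num.min i%:R (mdist x z)); first exact: segment_step_range.
move: iu1 iu2; rewrite /segment_steps; set u := c _ => iu1 iu2.
have e := segment_split sc (segment_step_range x z i); rewrite -/u in e.
have e1 := segment_split s1 u1r; have e2 := segment_split s2 u2r.
have := metric_triangle x (c1 u1) u; have := metric_triangle u (c1 u1) w.
have := metric_triangle w (c2 u2) u; have := metric_triangle u (c2 u2) z.
rewrite /gromov_product (metric_sym (c1 u1) u) (metric_sym (c2 u2) u) (metric_sym w u) (metric_sym z w).
lra.
Qed.

Lemma thin_hyperbolic K : 0 <= K -> thin_triangles K ->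
  hyperbolic (@mdist R X) (3 * K + 1).
Proof.
move=> K0 thin x y z w.
have [c1 s1] := geo x y; have [c2 s2] := geo y z; have [c3 s3] := geo x z.
have [t t01 tw] := thin_gromov_product_ge w K0 thin s3.
rewrite lerBlDr ge_min; apply/orP.
have [[s s01 sK]|[s s01 sK]] := thin _ _ _ _ _ _ s1 s2 s3 t t01; [left|right].
  have := gromov_product_le_segment w s1 s01; have := metric_triangle w (c3 t) (c1 s); lra.
have := gromov_product_le_segment w s2 s01; have := metric_triangle w (c3 t) (c2 s); lra.
Qed.

Variables (Y : Type) (d : Y -> Y -> R) (delta L : R) (r : X -> Y).
Hypothesis d_ge0 : forall a b, 0 <= d a b.
Hypothesis d_refl : forall a, d a a = 0.
Hypothesis d_sym : forall a b, d a b = d b a.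
Hypothesis d_tri : forall a b e, d a e <= d a b + d b e.
Hypothesis d_hyp : hyperbolic d delta.
Hypothesis d_geo : forall a b, exists v N,
  [/\ discrete_geodesic d v N, v 0%N = a & v N = b].
Hypothesis L1 : 1 <= L.
Hypothesis r_le : forall x y, d (r x) (r y) <= L * mdist x y + L.
Hypothesis r_ge : forall x y, mdist x y <= L * d (r x) (r y) + L.

Lemma segment_quasi_geodesic c x y : geodesic_segment c x y ->
  quasi_geodesic d (2 * L + 1) (r \o segment_steps c x y) (segment_length x y).
Proof.
move=> sc i j ijn; have [H1 H2] := segment_steps_dist sc ijn.
have L0 := L1; have L0' : 0 < L by lra.
split=> /=; last first.
  have := r_ge (segment_steps c x y i) (segment_steps c x y j).
  have := d_ge0 (r (segment_steps c x y i)) (r (segment_steps c x y j)).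
  set dd := d _ _ => dd0 ?.
  have : 0 <= L * dd by rewrite mulr_ge0 ?(ltW L0').
  by rewrite mulrDl mul1r -mulrA mulr_natl mulr2n; lra.
have /andP[ij _] := ijn; move: ij; rewrite leq_eqVlt => /orP[/eqP <-|ij].
  by rewrite subnn d_refl mulr0.
apply: le_trans (r_le _ _) _.
have k1 : 1 <= (j - i)%:R :> R by rewrite ler1n subn_gt0.
have : L * mdist (segment_steps c x y i) (segment_steps c x y j) <= L * (j - i)%:R.
  by rewrite ler_pM2l.
have : L * 1 <= L * (j - i)%:R by rewrite ler_pM2l.
by rewrite mulrDl mul1r -mulrA mulr_natl mulr2n; lra.
Qed.

(** A point [w] of a side of a triangle maps close to the images of the two end
    points, in the sense of Gromov products; by hyperbolicity of [Y] the same
    holds for one of the two other pairs of vertices, so the image of [w] comes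
    close to the image of the corresponding side. *)
Theorem hyperbolic_of_quasi_isometry (x0 : X) :
  exists delta', hyperbolic (@mdist R X) delta'.
Proof.
have L0 := L1; have d0 : 0 <= delta.
  by have := d_hyp (r x0) (r x0) (r x0) (r x0); rewrite /gromov_product d_refl minxx; lra.
have L21 : 1 <= 2 * L + 1 by lra.
have [C C0 CP] := quasi_geodesic_near_line d_ge0 d_refl d_sym d_tri d_hyp L21 d0 d_geo.
pose C2 := C + delta + (2 * delta + (2 * L + 1) + C).
pose K := L * C2 + L + 1.
have K0 : 0 <= K by rewrite addr_ge0// addr_ge0 ?mulr_ge0 /C2//; lra.
exists (3 * K + 1); apply: thin_hyperbolic => // x y z c1 c2 c3 s1 s2 s3 t t01.
pose i := Num.truncn t; have t0 : 0 <= t by case/andP: t01.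
have it : i%:R <= t by rewrite truncn_le.
have ti : t < i%:R + 1 by rewrite natr1 truncnS_gt.
have iN : (i <= segment_length x z)%N.
  by rewrite /segment_length (leq_trans _ (leqnSn _))// le_truncn//; case/andP: t01.
pose w := segment_steps c3 x z i.
have wE : w = c3 i%:R by rewrite /w /segment_steps min_l//; case/andP: t01; lra.
have wt : mdist (c3 t) w <= 1.
  rewrite wE; case: s3 => _ _ -> //; last by rewrite ler0n/=; case/andP: t01; lra.
  by rewrite ger0_norm; lra.
have wC := CP _ _ (segment_quasi_geodesic s3) i iN.
rewrite /= segment_steps0// segment_steps_end// -/w in wC.
have Hw := d_hyp (r x) (r y) (r z) (r w).
have near a b c : geodesic_segment c a b ->
    gromov_product d (r w) (r a) (r b) <= C + delta -> near_segment K c a b (c3 t).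
  move=> sc ab; have qg := segment_quasi_geodesic sc.
  have [j jN] := quasi_geodesic_meets d_refl d_sym d_tri d_hyp (r w) L21 qg (CP _ _ qg).
  rewrite /= segment_steps0// segment_steps_end// => wj.
  exists (Num.min j%:R (mdist a b)); first exact: segment_step_range.
  rewrite -/(segment_steps c a b j).
  have := metric_triangle (c3 t) w (segment_steps c a b j).
  have := r_ge w (segment_steps c a b j).
  have : L * d (r w) (r (segment_steps c a b j)) <= L * C2.
    by rewrite ler_pM2l /C2; lra.
  by rewrite /K; lra.
have : Num.min (gromov_product d (r w) (r x) (r y)) (gromov_product d (r w) (r y) (r z)) <= C + delta.
  by lra.
by rewrite ge_min => /orP[|] ?; [left|right]; exact: near.
Qed.

End ThinTriangles.

(** * Word metrics and geometric actions *)

Section WordMetric.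
Context {R : realType} {G : groupType}.
Variable S : set G.
Hypothesis gen : generates S.
Implicit Types (g h k u : G) (s : seq G).

Local Notation wd := (@word_dist R G S).
Local Notation prodw s := (\prod_(u <- s) u)%g.

Lemma word_in_cat s1 s2 : word_in S s1 -> word_in S s2 -> word_in S (s1 ++ s2).
Proof. by move=> S1 S2 u; rewrite mem_cat => /orP[/S1|/S2]. Qed.

Lemma word_in_inv s : word_in S s -> word_in S (rev [seq (u^-1)%g | u <- s]).
Proof.
move=> Ss u; rewrite mem_rev => /mapP[v /Ss + ->]; rewrite invgK.
by case; [right|left].
Qed.

Lemma prod_word_inv s : prodw (rev [seq (u^-1)%g | u <- s]) = ((prodw s)^-1)%g.
Proof. by rewrite -map_rev big_map prodgV revK. Qed.

Lemma word_dist_spec g h : exists s, [/\ word_in S s, prodw s = (g^-1 * h)%g,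
  wd g h = (size s)%:R & forall s', word_in S s' -> prodw s' = (g^-1 * h)%g ->
    (size s <= size s')%N].
Proof.
pose P n := `[< exists s, [/\ word_in S s, prodw s = (g^-1 * h)%g & size s = n] >].
have P0 : exists n, P n.
  have [s Ss sE] := gen (g^-1 * h)%g.
  by exists (size s); apply/asboolP; exists s.
have [n /asboolP[s [Ss sE sn]] nmin] := ex_minnP P0.
have smin s' : word_in S s' -> prodw s' = (g^-1 * h)%g -> (size s <= size s')%N.
  by move=> Ss' s'E; rewrite sn; apply: nmin; apply/asboolP; exists s'.
exists s; split=> //; apply/eqP; rewrite eq_le; apply/andP; split.
  apply: ge_inf; last by exists s.
  by exists 0 => _ [s' _ <-].
apply: lb_le_inf; first by exists (size s)%:R, s.
by move=> _ [s' [Ss' s'E] <-]; rewrite ler_nat; exact: smin.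
Qed.

Lemma word_dist_le g h s : word_in S s -> prodw s = (g^-1 * h)%g -> wd g h <= (size s)%:R.
Proof.
move=> Ss sE; have [s' [_ _ -> smin]] := word_dist_spec g h.
by rewrite ler_nat; exact: smin.
Qed.

Lemma word_dist_ge0 g h : 0 <= wd g h.
Proof. by have [s [_ _ -> _]] := word_dist_spec g h. Qed.

Lemma word_dist_refl g : wd g g = 0.
Proof.
apply/eqP; rewrite eq_le word_dist_ge0 andbT.
by apply: (@word_dist_le _ _ [::]) => //; rewrite big_nil mulVg.
Qed.

Lemma word_dist_sym g h : wd g h = wd h g.
Proof.
suff H g' h' : wd g' h' <= wd h' g' by apply/eqP; rewrite eq_le !H.
have [s [Ss sE -> _]] := word_dist_spec h' g'.
have := @word_dist_le g' h' _ (word_in_inv Ss).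
rewrite size_rev size_map; apply.
by rewrite prod_word_inv sE invgM invgK.
Qed.

Lemma word_dist_tri g h k : wd g k <= wd g h + wd h k.
Proof.
have [s [Ss sE -> _]] := word_dist_spec g h; have [t [St tE -> _]] := word_dist_spec h k.
rewrite -natrD -size_cat; apply: word_dist_le; first exact: word_in_cat.
by rewrite big_cat /= sE tE mulgA mulgK.
Qed.

Lemma word_dist_mul g s : word_in S s -> wd g (g * prodw s)%g <= (size s)%:R.
Proof. by move=> Ss; apply: word_dist_le => //; rewrite mulKg. Qed.

Lemma word_dist_geodesic g h : exists v N,
  [/\ discrete_geodesic wd v N, v 0%N = g & v N = h].
Proof.
have [s [Ss sE sN _]] := word_dist_spec g h.
pose v i := (g * prodw (take i s))%g.
have v0 : v 0%N = g by rewrite /v take0 big_nil mulg1.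
have vN : v (size s) = h by rewrite /v take_size sE mulVKg.
have vle i j : (i <= j <= size s)%N -> wd (v i) (v j) <= (j - i)%:R.
  move=> /andP[ij js].
  have -> : v j = (v i * prodw (drop i (take j s)))%g.
    rewrite /v -mulgA -big_cat /=; congr (_ * _)%g; congr (\prod_(u <- _) u)%g.
    by rewrite -{1}(cat_take_drop i (take j s)) take_takel.
  apply: le_trans (word_dist_mul _ _) _.
    by move=> u /mem_drop/mem_take/Ss.
  by rewrite size_drop size_takel.
exists v, (size s); split=> // i j /andP[ij js].
apply/eqP; rewrite eq_le vle ?ij//=.
have := word_dist_tri (v 0%N) (v i) (v (size s)).
have := word_dist_tri (v i) (v j) (v (size s)).
have := vle 0%N i; rewrite (leq_trans ij js) /= subn0 => /(_ isT).
have := vle j (size s); rewrite js leqnn /= => /(_ isT).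
have -> : wd (v 0%N) (v (size s)) = (size s)%:R by rewrite v0 vN.
by rewrite !natrB//; lra.
Qed.

End WordMetric.

Section GeometricActions.
Context {R : realType} {G : groupType} {X : metricType R}.
Variables (act : G -> X -> X) (x0 : X).
Hypothesis Xproper : proper_space X.
Hypothesis geo : geodesic_space X.
Hypothesis actP : geometric_action act.

Let act1 x : act 1%g x = x. Proof. by case: actP => -[]. Qed.
Let actM g h x : act (g * h)%g x = act g (act h x). Proof. by case: actP => -[_ ]. Qed.
Let act_isom g x y : mdist (act g x) (act g y) = mdist x y. Proof. by case: actP. Qed.
Let actKV g x : act g (act g^-1%g x) = x. Proof. by rewrite -actM mulgV act1. Qed.
Let actK g x : act g^-1%g (act g x) = x. Proof. by rewrite -actM mulVg act1. Qed.

Lemma act_isometry g : Defs.isometry (act g).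
Proof.
split; last exact: act_isom.
by exists (act g^-1%g) => x; rewrite ?actK ?actKV.
Qed.

Lemma orbit_cobounded : exists2 rho : R, 0 <= rho &
  forall x, exists g, mdist x (act g x0) <= rho.
Proof.
have [_ _ _ [K [Kc Kcov]]] := actP.
have [M KM] := compact_bounded_from x0 Kc.
exists (Num.max M 0) => [|x]; first by rewrite le_max lexx orbT.
have : (\bigcup_g (act g @` K)) x by rewrite Kcov.
move=> [g _ [k Kk <-]]; exists g; rewrite act_isom metric_sym.
by rewrite le_max KM.
Qed.

Lemma geometric_action_cobounded : cobounded X.
Proof.
have [_ _ _ [K [Kc Kcov]]] := actP; have [M KM] := compact_bounded_from x0 Kc.
exists K; split.
  exists (M + M) => x y Kx Ky; apply: le_trans (metric_triangle _ x0 _) _.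
  by rewrite (metric_sym x) lerD// KM.
move=> x; have : (\bigcup_g (act g @` K)) x by rewrite Kcov.
by move=> [g _ gx]; exists (act g); split=> //; exact: act_isometry.
Qed.

Lemma finite_set_bound (F : set G) (f : G -> R) : finite_set F ->
  exists2 M, 0 <= M & forall g, F g -> f g <= M.
Proof.
move=> /finite_seqP[s ->].
elim: s => [|g s [M M0 MP]]; first by exists 0.
exists (Num.max M (f g)) => [|h /=]; first by rewrite le_max M0.
rewrite inE le_max => /orP[/eqP ->|hs]; first by rewrite lexx orbT.
by rewrite MP.
Qed.

Variable S : set G.
Hypothesis Sfin : finite_set S.
Hypothesis gen : generates S.
Local Notation wd := (@word_dist R G S).

Lemma orbit_lipschitz : exists2 M, 0 <= M &
  forall g h, mdist (act g x0) (act h x0) <= M * wd g h.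
Proof.
have [M M0 MP] := finite_set_bound (fun g => mdist x0 (act g x0)) Sfin.
have SM u : S u \/ S u^-1%g -> mdist x0 (act u x0) <= M.
  case=> [/MP //|/MP]; rewrite -(act_isom u) actKV metric_sym//.
have wM s : word_in S s -> mdist x0 (act (\prod_(u <- s) u)%g x0) <= M * (size s)%:R.
  elim: s => [_|u s IH us]; first by rewrite big_nil act1 mdistxx mulr0.
  rewrite big_cons actM /= -natr1 mulrDr mulr1 addrC.
  apply: le_trans (metric_triangle _ (act u x0) _) _; apply: lerD.
    by apply: SM; apply: us; rewrite mem_head.
  by rewrite act_isom; apply: IH => v vs; apply: us; rewrite inE vs orbT.
exists M => // g h; have [s [Ss sE -> _]] := word_dist_spec (R := R) gen g h.
have := wM s Ss; rewrite sE actM -(act_isom g).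
by rewrite actKV.
Qed.

(** Only finitely many group elements move [x0] by at most [2 * rho + 1].  A
    segment between two orbit points is followed in steps of length [1], each of
    its points being within [rho] of the orbit. *)
Lemma orbit_expanding rho : 0 <= rho -> (forall x, exists g, mdist x (act g x0) <= rho) ->
  exists2 M, 0 <= M & forall g h, wd g h <= M * mdist (act g x0) (act h x0) + 2 * M.
Proof.
move=> rho0 orb; have [_ _ fin _] := actP.
have [M M0 MP] := finite_set_bound (fun g => wd 1%g g) (fin _ (Xproper (x := x0) (r := 2 * rho + 1))).
have close g h : mdist (act g x0) (act h x0) <= 2 * rho + 1 -> wd g h <= M.
  move=> gh; rewrite (_ : wd g h = wd 1%g (g^-1 * h)%g); last first.
    by rewrite /word_dist invg1 mul1g.
  apply: MP; exists (act (g^-1 * h)%g x0); split.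
    by exists x0 => //=; rewrite mdistxx; lra.
  by rewrite /= -(act_isom g) actM actKV.
exists M => // g h; pose l := mdist (act g x0) (act h x0).
suff H (n : nat) k p : mdist (act g x0) p <= n%:R -> mdist p (act k x0) <= rho ->
    wd g k <= n.+1%:R * M.
  have ln : l <= (Num.truncn l).+1%:R by rewrite ltW// truncnS_gt.
  have := H _ h (act h x0) ln; rewrite mdistxx => /(_ rho0) /le_trans; apply.
  have l0 : 0 <= l := mdist_ge0 _ _.
  rewrite -natr1 -natr1 -addrA mulrDl (mulrC M) lerD//.
    by rewrite ler_wpM2r// truncn_le.
elim: n k p => [|n IH] k p gp pk.
  rewrite mul1r; apply: close; apply: le_trans (metric_triangle _ p _) _; lra.
have [c sc] := geo (act g x0) p.
pose t := Num.min n%:R (mdist (act g x0) p).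
have t01 : 0 <= t <= mdist (act g x0) p by rewrite le_min ler0n mdist_ge0 ge_min lexx orbT.
have gt := segment_dist_start sc t01.
have split_t := segment_split sc t01; rewrite gt in split_t.
have tn : t <= n%:R by rewrite ge_min lexx.
have tp : mdist (c t) p <= 1.
  move: gp split_t; rewrite -natr1 /t; case: (leP n%:R (mdist (act g x0) p)) => _; lra.
have [k' ck'] := orb (c t).
have := IH k' (c t); rewrite gt => /(_ tn ck') H1.
have H2 : wd k' k <= M.
  apply: close; apply: le_trans (metric_triangle _ (c t) _) _.
  have := metric_triangle (c t) p (act k x0); rewrite (metric_sym _ (c t)); lra.
have := word_dist_tri (R := R) gen g k' k; rewrite -[n.+2%:R]natr1 mulrDl mul1r; lra.
Qed.

Lemma geometric_action_hyperbolic delta : hyperbolic wd delta ->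
  exists delta', hyperbolic (@mdist R X) delta'.
Proof.
move=> hyp; have [rho rho0 orb] := orbit_cobounded.
have [r rP] := choice orb.
have [M M0 MP] := orbit_lipschitz; have [M' M'0 M'P] := orbit_expanding rho0 orb.
pose L := 1 + M + M' + 2 * rho + M' * (2 * rho) + 2 * M'.
have M'r : 0 <= M' * (2 * rho) by rewrite !mulr_ge0.
have L1 : 1 <= L by rewrite /L; lra.
apply: (@hyperbolic_of_quasi_isometry _ _ geo G wd delta L r) => //.
- exact: word_dist_ge0.
- exact: word_dist_refl.
- exact: word_dist_sym.
- exact: word_dist_tri.
- exact: word_dist_geodesic.
- move=> x y; apply: le_trans (M'P _ _) _.
  have rxy : mdist (act (r x) x0) (act (r y) x0) <= mdist x y + 2 * rho.
    have := metric_triangle (act (r x) x0) x (act (r y) x0).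
    have := metric_triangle x y (act (r y) x0).
    have := rP x; have := rP y; rewrite (metric_sym (act (r x) x0) x); lra.
  have : M' * mdist (act (r x) x0) (act (r y) x0) <= M' * (mdist x y + 2 * rho).
    exact: ler_wpM2l.
  have : M' * mdist x y <= L * mdist x y by rewrite ler_wpM2r ?mdist_ge0// /L; lra.
  rewrite /L; lra.
- move=> x y.
  have := metric_triangle x (act (r x) x0) y.
  have := metric_triangle (act (r x) x0) (act (r y) x0) y.
  have := rP x; have := rP y; rewrite (metric_sym (act (r y) x0) y).
  have := MP (r x) (r y).
  have : M * wd (r x) (r y) <= L * wd (r x) (r y).
    by rewrite ler_wpM2r ?word_dist_ge0// /L; lra.
  rewrite /L; lra.
Qed.

End GeometricActions.

(** * Equality of the capacity dimensions *)

Theorem cdim_visual_conical (R : realType) (X : metricType R) (delta : R) (x0 : X)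
    (eps A : R) : proper_space X -> cat0 X -> hyperbolic (@mdist R X) delta ->
  cobounded X -> 0 < eps -> expR (eps * delta) - 1 <= Num.sqrt 2 - 1 -> 0 < A ->
  cdim (visual_dist x0 eps) = cdim (conical_dist x0 A).
Proof.
move=> Xproper X0 Xhyp Xcob eps0 eps_delta A0.
apply: (cdim_gauged_eq (agree_scale_relation x0 X0 Xproper Xhyp)).
- exact: agree_doubling.
- exact: agree_self_similar.
- by move=> a b; exact: agree_le0.
- exact: visual_dist_gauged.
- exact: conical_dist_gauged.
Qed.

Theorem theorem1p3 (R : realType) :
  (forall (X : metricType R) (delta : R) (x0 : X) (eps A : R),
     proper_space X -> geodesic_space X -> cat0 X ->
     hyperbolic (@mdist R X) delta -> cobounded X ->
     0 < eps -> expR (eps * delta) - 1 <= Num.sqrt 2 - 1 -> 0 < A ->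
     cdim (visual_dist x0 eps) = cdim (conical_dist x0 A)) /\
  (forall (G : groupType) (X : metricType R) (act : G -> X -> X),
     hyperbolic_group R G -> proper_space X -> cat0 X ->
     geometric_action act ->
     (exists delta : R, hyperbolic (@mdist R X) delta) /\
     (forall (delta : R) (x0 : X) (eps A : R),
        hyperbolic (@mdist R X) delta ->
        0 < eps -> expR (eps * delta) - 1 <= Num.sqrt 2 - 1 -> 0 < A ->
        cdim (visual_dist x0 eps) = cdim (conical_dist x0 A))).
Proof.
split=> [X delta x0 eps A Xproper _ X0 Xhyp Xcob|G X act hypG Xproper X0 actX].
  exact: cdim_visual_conical.
split=> [|delta x0 eps A Xhyp].
  have [[x0 _]|noX] := pselect (exists x : X, True); last first.
    by exists 0 => x; exfalso; apply: noX; exists x.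
  have [S [delta [Sfin gen hyp]]] := hypG.
  exact: geometric_action_hyperbolic x0 Xproper X0.1 actX S Sfin gen delta hyp.
apply: cdim_visual_conical => //; exact: geometric_action_cobounded x0 actX.
Qed.
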